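(* Let $G$ be a totally disconnected locally compact group and let $M$ be a discrete left $\mathbb{Q}[G]$-module. The following are equivalent: (a) the discrete $\mathbb{Q}[G]$-module $M$ is flat; (b) for every morphism $f\colon P_1\to P_2$ of finitely generated proper discrete permutation $\mathbb{Q}[G]$-modules and every morphism $\phi_2\colon P_2\to M$ of $\mathbb{Q}[G]$-modules such that $\phi_2\circ f=0$, there exist a finitely generated proper discrete permutation $\mathbb{Q}[G]$-module $P_3$, a morphism $f'\colon P_2\to P_3$ and a morphism $\phi_3\colon P_3\to M$ such that $f'\circ f=0$ and $\phi_2=\phi_3\circ f'$; (c) $M$ is a direct limit of finitely generated proper discrete permutation $\mathbb{Q}[G]$-modules.
   Context: An abstract (left or right) $\mathbb{Q}[G]$-module $M$ is discrete if the stabiliser $\{g\in G: g\text{ fixes }m\}$ is an open subgroup of $G$ for every $m\in M$. Discrete left (resp. right) modules form a full abelian subcategory of the category of abstract left (resp. right) $\mathbb{Q}[G]$-modules. A proper discrete permutation $\mathbb{Q}[G]$-module is a module $\mathbb{Q}[\Omega]$ freely $\mathbb{Q}$-spanned by a left $G$-set $\Omega$ all of whose point stabilisers are compact open subgroups of $G$; it is isomorphic to a direct sum of modules $\mathbb{Q}[G/U]$ with $U$ compact open, and it is finitely generated if and only if $\Omega$ has finitely many $G$-orbits. A discrete left $\mathbb{Q}[G]$-module $M$ is flat if the functor $-\otimes_G M=-\otimes_{\mathbb{Q}[G]}M$, from discrete right $\mathbb{Q}[G]$-modules to $\mathbb{Q}$-vector spaces, is exact. ''Direct limit'' means colimit over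 a directed system. *)

(* Defs.v *)
From HB Require Import structures.
From mathcomp Require Import all_boot all_order all_algebra finmap.
From mathcomp Require Import all_classical topology.
From mathcomp Require Import monalg.

Set Implicit Arguments.
Unset Strict Implicit.
Unset Printing Implicit Defensive.

Import GRing.Theory.
Local Open Scope classical_set_scope.
Local Open Scope ring_scope.

(* Topological groups.  No separation axiom is imposed: total disconnectedness
   makes the points closed, hence the group Hausdorff. *)
HB.mixin Record isTopologicalGroup G of Topological G & Group G := {
  mulg_continuous : continuous (fun x : G * G => (x.1 * x.2)%g);
  invg_continuous : continuous (fun x : G => (x^-1)%g)
}.

#[short(type="topologicalGroupType")]
HB.structure Definition TopologicalGroup :=
  {G of Topological G & Group G & isTopologicalGroup G}.

(* A Q[G]-module is encoded as a Q-vector space with a Q-linear action of G. *)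
Record lmodQG (G : groupType) := LmodQG {
  lmodQG_sort :> lmodType rat;
  lact : G -> lmodQG_sort -> lmodQG_sort;
  lact_linear : forall g, linear (lact g);
  lact1 : forall x, lact 1%g x = x;
  lactM : forall g h x, lact (g * h)%g x = lact g (lact h x)
}.

Record rmodQG (G : groupType) := RmodQG {
  rmodQG_sort :> lmodType rat;
  ract : rmodQG_sort -> G -> rmodQG_sort;
  ract_linear : forall g, linear (ract^~ g);
  ract1 : forall x, ract x 1%g = x;
  ractM : forall x g h, ract x (g * h)%g = ract (ract x g) h
}.

Record lhom (G : groupType) (M N : lmodQG G) := LHom {
  lhom_fun :> {linear M -> N};
  lhom_act : forall g x, lhom_fun (lact g x) = lact g (lhom_fun x)
}.

Record rhom (G : groupType) (M N : rmodQG G) := RHom {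
  rhom_fun :> {linear M -> N};
  rhom_act : forall x g, rhom_fun (ract x g) = ract (rhom_fun x) g
}.

Definition ldiscrete (G : topologicalGroupType) (M : lmodQG G) : Prop :=
  forall m : M, open [set g : G | lact g m = m].

Definition rdiscrete (G : topologicalGroupType) (M : rmodQG G) : Prop :=
  forall m : M, open [set g : G | ract m g = m].

Record gSet (G : groupType) := GSet {
  gSet_sort :> choiceType;
  gact : G -> gSet_sort -> gSet_sort;
  gact1 : forall w, gact 1%g w = w;
  gactM : forall g h w, gact (g * h)%g w = gact g (gact h w)
}.

(* [e] exhibits the G-set [W] as a Q-basis of [P], i.e. P = Q[W]. *)
Definition freely_spanned_by (G : groupType) (P : lmodQG G) (W : gSet G)
    (e : W -> P) : Prop :=
  [/\ forall g w, e (gact g w) = lact g (e w),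
      forall x : P, exists (s : seq W) (c : W -> rat),
        x = \sum_(w <- s) c w *: e w
    & forall (s : seq W) (c : W -> rat), uniq s ->
        \sum_(w <- s) c w *: e w = 0 -> forall w, w \in s -> c w = 0].

Definition proper_discrete_permutation (G : topologicalGroupType)
    (P : lmodQG G) : Prop :=
  exists (W : gSet G) (e : W -> P), freely_spanned_by e /\
    forall w : W, open [set g : G | gact g w = w] /\
                  compact [set g : G | gact g w = w].

Definition subspace_closed (V : lmodType rat) (S : set V) : Prop :=
  S 0 /\ forall (a : rat) x y, S x -> S y -> S (a *: x + y).

Definition submodule_closed (G : groupType) (M : lmodQG G) (S : set M) : Prop :=
  subspace_closed S /\ forall g x, S x -> S (lact g x).

Definition finitely_generated (G : groupType) (M : lmodQG G) : Prop :=
  exists s : seq M, forall S : set M, submodule_closed S ->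
    (forall x, x \in s -> S x) -> S = setT.

Definition fg_proper_permutation (G : topologicalGroupType)
    (P : lmodQG G) : Prop :=
  proper_discrete_permutation P /\ finitely_generated P.

Definition short_exact (U V W : lmodType rat) (i : U -> V) (p : V -> W) : Prop :=
  [/\ injective i, range i = [set y | p y = 0] & range p = setT].

Section SpanQuotient.
Variables (V : lmodType rat) (X : set V).

Definition span : set V :=
  [set x | forall S : set V, subspace_closed S -> X `<=` S -> S x].

Definition spanb : {pred V} := fun x => `[< span x >].

Fact spanb_submod_closed : submod_closed spanb.
Proof.
split=> [|a x y /asboolP xs /asboolP ys]; apply/asboolP => S sS XS.
  by case: sS.
by case: (sS) => _; apply; [exact: xs | exact: ys].
Qed.

HB.instance Definition _ := GRing.isSubmodClosed.Build rat V spanb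
  spanb_submod_closed.

Definition quot_span := Quotient.quot spanb.
HB.instance Definition _ := GRing.Zmodule.on quot_span.

Definition qclass : V -> quot_span := \pi_(Quotient.quot spanb)%qT.

Fact qclass_is_zmod_morphism : zmod_morphism qclass.
Proof. exact: (raddfB \pi_(Quotient.quot spanb)%qT). Qed.

HB.instance Definition _ := GRing.isZmodMorphism.Build V quot_span qclass
  qclass_is_zmod_morphism.

Lemma qclass_eq x y : qclass x = qclass y <-> span (x - y).
Proof.
rewrite -[span _]asboolE -/(spanb (x - y)) -[spanb _]/(x - y \in spanb).
rewrite Quotient.idealrBE; split=> [/eqP//|/eqP//].
Qed.

Lemma qclass_repr (x : quot_span) : qclass (repr (x : Quotient.quot spanb)) = x.
Proof. exact: reprK. Qed.

Definition qscale (a : rat) (x : quot_span) : quot_span :=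
  qclass (a *: repr (x : Quotient.quot spanb)).

Lemma qscaleE a x : qscale a (qclass x) = qclass (a *: x).
Proof.
apply/qclass_eq; rewrite -scalerBr.
have /qclass_eq h : qclass (repr (qclass x : Quotient.quot spanb)) = qclass x.
  exact: qclass_repr.
move=> S sS XS; have := h S sS XS; case: sS => S0 SZ Sx.
by rewrite -[_ *: _]addr0; exact: SZ.
Qed.

Let qind (P : quot_span -> Prop) : (forall x, P (qclass x)) -> forall x, P x.
Proof. by move=> h x; rewrite -(qclass_repr x). Qed.

Fact qscaleA a b x : qscale a (qscale b x) = qscale (a * b) x.
Proof. by elim/qind: x => x; rewrite !qscaleE scalerA. Qed.
Fact qscale1 : left_id 1 qscale.
Proof. by elim/qind => x; rewrite qscaleE scale1r. Qed.
Fact qscaleDr : right_distributive qscale +%R.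
Proof.
by move=> a; elim/qind => x; elim/qind => y;
   rewrite !qscaleE -!raddfD qscaleE /= scalerDr.
Qed.
Fact qscaleDl x : {morph qscale^~ x : a b / a + b}.
Proof. by elim/qind: x => x a b; rewrite !qscaleE -raddfD scalerDl. Qed.

HB.instance Definition _ := GRing.Zmodule_isLmodule.Build rat quot_span
  qscaleA qscale1 qscaleDr qscaleDl.

Fact qclass_is_scalable : scalable qclass.
Proof. by move=> a x; rewrite -[RHS]/(qscale a _) qscaleE. Qed.

HB.instance Definition _ := GRing.isScalable.Build rat V quot_span *:%R qclass
  qclass_is_scalable.

End SpanQuotient.

Section FreeLift.
Variables (K : choiceType) (W : lmodType rat) (h : K -> W).

Definition free_lift (x : {malg rat[K]}) : W := \sum_(k <- msupp x) x@_k *: h k.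

Lemma free_liftEw (d : {fset K}) (x : {malg rat[K]}) : (msupp x `<=` d)%fset ->
  free_lift x = \sum_(k <- d) x@_k *: h k.
Proof.
move=> le; rewrite /free_lift (big_fset_incl _ le) //= => k _ kx.
by rewrite mcoeff_outdom // scale0r.
Qed.

Fact free_lift_is_linear : linear free_lift.
Proof.
move=> a x y; set d := (msupp x `|` msupp y)%fset.
have xd : (msupp x `<=` d)%fset by exact: fsubsetUl.
have yd : (msupp y `<=` d)%fset by exact: fsubsetUr.
have axyd : (msupp (a *: x + y) `<=` d)%fset.
  exact: fsubset_trans (msuppD_le _ _) (fsetSU _ (msuppZ_le _ _)).
rewrite (free_liftEw xd) (free_liftEw yd) (free_liftEw axyd).
rewrite scaler_sumr -big_split; apply: eq_bigr => k _ /=.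
by rewrite mcoeffD mcoeffZ scalerDl scalerA.
Qed.

HB.instance Definition _ := GRing.isLinear.Build rat {malg rat[K]} W *:%R
  free_lift free_lift_is_linear.

Lemma free_liftU k : free_lift << 1 *g k >> = h k.
Proof. by rewrite /free_lift msuppU oner_eq0 big_seq_fset1 mcoeffUU scale1r. Qed.

End FreeLift.

Definition balanced (G : groupType) (A : rmodQG G) (M : lmodQG G)
    (W : lmodType rat) (b : A -> M -> W) : Prop :=
  [/\ forall m, linear (b^~ m), forall a, linear (b a)
    & forall a g m, b (ract a g) m = b a (lact g m)].

Section Tensor.
Variables (G : groupType) (A : rmodQG G) (M : lmodQG G).

Local Notation free := {malg rat[(A * M)%type]}.
Local Notation gen a m := (<< 1 *g (a, m) >> : free).

(* The last clause is the only one involving G: without it the quotient of the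
   free vector space on A * M is the tensor product over Q. *)
Definition tensor_relations : set free :=
  [set x | (exists q a a' m,
              x = gen (q *: a + a') m - (q *: gen a m + gen a' m))
        \/ (exists q a m m',
              x = gen a (q *: m + m') - (q *: gen a m + gen a m'))
        \/ (exists a g m, x = gen (ract a g) m - gen a (lact g m))].

Definition tensor : lmodType rat := quot_span tensor_relations.

Definition tens (a : A) (m : M) : tensor := qclass tensor_relations (gen a m).

Lemma tens_balanced : balanced tens.
Proof.
have R x y : tensor_relations (x - y) ->
    qclass tensor_relations x = qclass tensor_relations y.
  by move=> xy; apply/qclass_eq => S _; apply.
split=> [m q a a'|a q m m'|a g m]; rewrite /tens.
- by rewrite -linearP; apply: R; left; exists q, a, a', m.
- by rewrite -linearP; apply: R; right; left; exists q, a, m, m'.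
- by apply: R; right; right; exists a, g, m.
Qed.

Local Notation Q := (Quotient.quot (spanb tensor_relations)).

Definition tensor_lift (W : lmodType rat) (b : A -> M -> W) (x : tensor) : W :=
  free_lift (fun am => b am.1 am.2) (repr (x : Q)).

Lemma tensor_lift_qclass (W : lmodType rat) (b : A -> M -> W) x : balanced b ->
  tensor_lift b (qclass tensor_relations x) =
  free_lift (fun am => b am.1 am.2) x.
Proof.
case=> bl br bG; set h := fun am => _.
have /qclass_eq hx :
    qclass tensor_relations (repr (qclass tensor_relations x : Q)) =
    qclass tensor_relations x by exact: qclass_repr.
apply/eqP; rewrite -subr_eq0 /tensor_lift -/h -linearB /=; apply/eqP.
apply: (hx [set z | free_lift h z = 0]).
  split=> [|q y z /= y0 z0]; first exact: linear0.
  by rewrite free_lift_is_linear y0 z0 scaler0 addr0.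
move=> _ [[q [a [a' [m ->]]]]|[[q [a [m [m' ->]]]]|[a [g [m ->]]]]] /=;
  rewrite linearB /= ?free_lift_is_linear !free_liftU /h /=.
- by rewrite (bl m q a a') subrr.
- by rewrite (br a q m m') subrr.
- by rewrite bG subrr.
Qed.

Lemma tensor_lift_linear (W : lmodType rat) (b : A -> M -> W) : balanced b ->
  linear (tensor_lift b).
Proof.
move=> bb q x y; rewrite -(qclass_repr x) -(qclass_repr y) -linearP.
by rewrite !tensor_lift_qclass // linearP.
Qed.

Lemma tensor_liftE (W : lmodType rat) (b : A -> M -> W) a m : balanced b ->
  tensor_lift b (tens a m) = b a m.
Proof. by move=> bb; rewrite tensor_lift_qclass // free_liftU. Qed.

End Tensor.

Section TensorMap.
Variables (G : groupType) (A B : rmodQG G) (f : rhom A B) (M : lmodQG G).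

Fact tensor_map_balanced : balanced (fun a (m : M) => tens (f a) m).
Proof.
have [bl br bG] := tens_balanced B M.
split=> [m q a a'|a|a g m]; first by rewrite linearP bl.
  exact: br.
by rewrite rhom_act bG.
Qed.

Definition tensor_map : tensor A M -> tensor B M :=
  tensor_lift (fun a m => tens (f a) m).

Fact tensor_map_is_linear : linear tensor_map.
Proof. exact/tensor_lift_linear/tensor_map_balanced. Qed.

HB.instance Definition _ := GRing.isLinear.Build rat (tensor A M) (tensor B M)
  *:%R tensor_map tensor_map_is_linear.

Lemma tensor_mapE a m : tensor_map (tens a m) = tens (f a) m.
Proof. exact/tensor_liftE/tensor_map_balanced. Qed.

End TensorMap.
Arguments tensor_map {G A B} f M _.

Definition flat (G : topologicalGroupType) (M : lmodQG G) : Prop :=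
  forall (A B C : rmodQG G) (i : rhom A B) (p : rhom B C),
    rdiscrete A -> rdiscrete B -> rdiscrete C ->
    short_exact i p -> short_exact (tensor_map i M) (tensor_map p M).

(* The index set is a nonempty directed preorder; the transition maps may
   depend on the proof of i <= j only formally, by [dsys_id] and [dsys_comp]. *)
Record directed_system (G : groupType) := DirectedSystem {
  dsys_index : Type;
  dsys_le : rel dsys_index;
  dsys_refl : reflexive dsys_le;
  dsys_trans : transitive dsys_le;
  dsys_inhabited : inhabited dsys_index;
  dsys_directed : forall i j, exists k, dsys_le i k /\ dsys_le j k;
  dsys_obj : dsys_index -> lmodQG G;
  dsys_map : forall i j, dsys_le i j -> lhom (dsys_obj i) (dsys_obj j);
  dsys_id : forall i (ii : dsys_le i i) x, dsys_map ii x = x;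
  dsys_comp : forall i j k (ij : dsys_le i j) (jk : dsys_le j k)
    (ik : dsys_le i k) x, dsys_map ik x = dsys_map jk (dsys_map ij x)
}.

Arguments dsys_obj {G} d i.

Definition cocone (G : groupType) (D : directed_system G) (N : lmodQG G)
    (c : forall i, lhom (dsys_obj D i) N) : Prop :=
  forall i j (ij : dsys_le i j) x, c j (dsys_map ij x) = c i x.

(* Colimit in the category of discrete left Q[G]-modules. *)
Definition is_direct_limit (G : topologicalGroupType) (D : directed_system G)
    (M : lmodQG G) (c : forall i, lhom (dsys_obj D i) M) : Prop :=
  cocone c /\
  forall (N : lmodQG G) (d : forall i, lhom (dsys_obj D i) N),
    ldiscrete N -> cocone d ->
    exists h : lhom M N, (forall i x, h (c i x) = d i x) /\
      forall h' : lhom M N, (forall i x, h' (c i x) = d i x) -> h' =1 h.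

(* Main.v *)
From HB Require Import structures.
From mathcomp Require Import all_boot all_algebra finmap.
From mathcomp Require Import all_classical topology.
From mathcomp Require Import monalg.
Require Import Defs.

(** The proof goes round the implications: flat, then relations factor, then
    direct limit, then flat. It rests on two facts about a totally disconnected
    locally compact group [G] and rational coefficients. Compact open subgroups form
    a basis of neighbourhoods of the identity ([van_dantzig]), so each vector of a
    discrete module is fixed by one. And since orbits of a compact open subgroup
    [V] on a discrete module are finite, there is a linear projection [average] onto the
    [V]-fixed vectors, natural in the module, whose kernel is spanned by the differences
    [v m - m]. Every finitely generated proper permutation module is a retract of a
    module [coset_module V], the sum of Q[G/V_k] over a finite family of compact open
    subgroups ([fg_proper_retract]); the latter has generators [w_k], and a homomorphism
    from it is a choice of V_k-fixed vectors.

    Duality is the main device. Made into a right module by inverting group elements,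
    [L = coset_module V] is its own dual: for discrete [N], the coefficients of an element
    of [L] against the generators, averaged over the V_k, define invariant bilinear
    maps [pairing k : L -> N -> N].
    Applied to tensors, the pairing shows that [L] is flat
    ([coset_module_preserves_injections]).

    If [M] is flat and [f : L -> M] kills finitely many vectors [y_l], choose [U]
    fixing all [y_l] and let [R] be the sum of copies of Q[G/U], one for each [l]. The
    vectors [y_l] have a transpose [L -> R] ([dual_map]), which sends the tensor
    [tau], the sum of the [w_k (x) f w_k] in the tensor product of [L] and [M], to the
    sum of the [om_l (x) f y_l], that is, to zero ([sum_tens_pairing]); here [om_l] are the
    generators of [R]. Flatness writes [tau] as a sum of [kap_i (x) m_i] with [kap_i]
    killed by the transpose ([flat_kernel]). Pairing with the [kap_i] then defines the
    required factorisation of [f] through a coset module with generators over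
    the [m_i] ([flat_kills_relations]).

    If relations factor, [M] is the limit of the coset modules over [M] that are
    generated by finitely many elements labelled by pairs of an integer and their image
    in [M]. Maps that respect labels are unique, so these form a preorder. It is directed,
    and elements over zero eventually die, because the factorisation property
    identifies finitely many pairs of elements and then allows the new generators to be
    labelled as well ([stage_extension]).

    Finally, comparison with an explicit colimit shows that a direct limit among
    discrete modules is one elementwise ([direct_limit_concrete]), and tensor products
    commute with such limits ([tensor_ker]), so a limit of flat modules is flat. *)

Set Implicit Arguments.
Unset Strict Implicit.
Unset Printing Implicit Defensive.

Import GRing.Theory.
Local Open Scope classical_set_scope.
Local Open Scope ring_scope.

(** * Totally disconnected locally compact groups *)

Section CompactIntersection.
Variable T : topologicalType.

(** The finite intersection property, for a filtering family of closed sets. *)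
Lemma compact_directed (K : set T) (F : set (set T)) :
  compact K -> F !=set0 -> (forall A, F A -> closed A) ->
  (forall A B, F A -> F B -> exists2 C, F C & C `<=` A `&` B) ->
  (forall x, K x -> exists2 A, F A & ~ A x) ->
  exists2 A, F A & K `&` A = set0.
Proof.
move=> Kc [A0 FA0] Fcl Fdir KF; apply: contrapT => noA.
have ne A : F A -> A `&` K !=set0.
  move=> FA; apply/set0P/eqP => AK0; apply: noA.
  by exists A => //; rewrite setIC.
pose E := filter_from F (fun A => A `&` K).
have Efil : Filter E.
  apply: filter_from_filter; first by exists A0.
  move=> A B FA FB; have [C FC CAB] := Fdir _ _ FA FB.
  by exists C => // x [/CAB[Ax Bx] Kx].
have Epr : ProperFilter E by apply: filter_from_proper.
have EK : E K by exists A0 => // x [].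
have [x [Kx clx]] := Kc E Epr EK.
have [A FA nAx] := KF x Kx; apply: nAx; apply: (Fcl _ FA) => B Bx.
have EA : E A by exists A => // y [].
exact: clx.
Qed.

Lemma connected_sub1 (x : T) (Q : set T) :
  totally_disconnected [set: T] -> connected Q -> Q x -> Q `<=` [set x].
Proof.
by move=> td Qc Qx; rewrite -(td x I) => y Qy; exists Q.
Qed.

End CompactIntersection.

Section TopologicalGroup.
Variable G : topologicalGroupType.
Implicit Types (A B C H U V W : set G) (g h x y : G).

Lemma mulg_nbhs x y U : nbhs (x * y)%g U ->
  \forall a \near x & b \near y, U (a * b)%g.
Proof. exact: (@mulg_continuous G (x, y) U). Qed.

Lemma open_translate g U : open U -> open [set x | U (g * x)%g].
Proof.
rewrite !openE => Uo x /= /Uo /mulg_nbhs [[P Q] [/= Px Qx] PQ].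
apply: filterS Qx => y Qy; apply: (PQ (g, y)); split=> //=.
exact: nbhs_singleton.
Qed.

Lemma open_rtranslate g U : open U -> open [set x | U (x * g)%g].
Proof.
rewrite !openE => Uo x /= /Uo /mulg_nbhs [[P Q] [/= Px Qx] PQ].
apply: filterS Px => y Py; apply: (PQ (y, g)); split=> //=.
exact: nbhs_singleton.
Qed.

Lemma nbhs_div W : nbhs 1%g W ->
  exists2 U, open_nbhs 1%g U & forall a b, U a -> U b -> W (a * b^-1)%g.
Proof.
rewrite -[1%g in X in X -> _](mulg1 (1 : G)%g).
move=> /mulg_nbhs [[P Q] [/= P1 Q1] PQ].
have Q1' : nbhs (1%g : G) [set x | Q (x^-1)%g].
  by apply: (@invg_continuous G 1%g Q); rewrite invg1.
have : nbhs (1%g : G) (P `&` [set x | Q (x^-1)%g]) by exact: filterI.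
rewrite nbhsE => -[O O1 OPQ].
exists O => // a b /OPQ[Pa _] /OPQ[_ Qb]; exact: (PQ (a, b^-1)%g).
Qed.

(** By the tube lemma [A * W] misses [B] for some neighbourhood [W] of the identity;
    if [O * O^-1] lies in [W], then [A * O] and [B * O] are disjoint. *)
Lemma compact_closed_separate A B : compact A -> closed B -> A `&` B = set0 ->
  exists U V, [/\ open U, open V, A `<=` U, B `<=` V & U `&` V = set0].
Proof.
move=> /compact_near_coveringP Ac Bcl AB0.
have W1 : nbhs (1%g : G) (fun b => A `<=` fun a => (~` B) (a * b)%g).
  apply: Ac => x Ax; apply: (@mulg_nbhs x 1%g (~` B)); rewrite mulg1.
  apply: open_nbhs_nbhs.
  split; first exact: closed_openC.
  by move=> Bx; rewrite -[False]/(set0 x) -AB0.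
have [O [Oo O1] OW] := nbhs_div W1.
have op D : open (\bigcup_(d in D) [set x | O (d^-1 * x)%g]).
  by apply: bigcup_open => d _; exact: open_translate.
exists (\bigcup_(d in A) [set x | O (d^-1 * x)%g]).
exists (\bigcup_(d in B) [set x | O (d^-1 * x)%g]); split=> //.
- by move=> x Ax; exists x => //=; rewrite mulVg.
- by move=> x Ax; exists x => //=; rewrite mulVg.
apply/seteqP; split=> // x [[a Aa /= Oa] [b Bb /= Ob]].
apply: (OW _ _ Oa Ob a Aa).
by rewrite invgM invgK !mulgA mulgV mul1g mulgV mul1g.
Qed.

(** The relatively clopen subsets of a compact set that contain a given point have a
    connected intersection, hence meet in that point alone; by compactness one
    of them lies in any prescribed neighbourhood. *)
Lemma clopen_base C (O : set G) x :
  totally_disconnected [set: G] -> compact C -> closed C -> nbhs x C ->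
  open O -> O x -> exists K, [/\ K x, open K, compact K & K `<=` O].
Proof.
move=> td Cc Ccl Cx Oo Ox.
have xC : C x by exact: nbhs_singleton.
pose F := [set K : set G | [/\ K x, K `<=` C, closed K & closed (C `\` K)]].
have FC : F C by split=> //; rewrite setDv; exact: closed0.
have Fcl A : F A -> closed A by case.
have FI A B : F A -> F B -> F (A `&` B).
  move=> [Ax AC Ac Ad] [Bx BC Bc Bd]; split=> //; first by move=> y [/AC].
    exact: closedI.
  by rewrite setDIr; exact: closedU.
have Fdir A B : F A -> F B -> exists2 D, F D & D `<=` A `&` B.
  by move=> FA FB; exists (A `&` B) => //; exact: FI.
pose Q := \bigcap_(K in F) K.
have QC : Q `<=` C by move=> y; apply.
have Qcl : closed Q by exact: closed_bigI.
have Qx : Q x by move=> K [].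
(* An open set containing the intersection of the family contains a member. *)
have FQ U : open U -> Q `<=` U -> exists2 K, F K & K `<=` U.
  move=> Uo QU; have CUc : compact (C `&` ~` U).
    by apply: compact_closedI => //; exact: open_closedC.
  have [|y [Cy nUy]|K FK KU] := compact_directed CUc _ Fcl Fdir.
  - by exists C.
  - apply: contrapT => h; apply/nUy/QU => K FK.
    by apply: contrapT => nKy; apply: h; exists K.
  exists K => // y Ky; apply: contrapT => nUy.
  rewrite -[False]/(set0 y) -KU; split=> //; split=> //.
  by case: FK => _ KC _ _; exact: KC.
(* [Q] has no nontrivial partition into closed sets: a clopen [K] inside disjoint
   neighbourhoods [U], [V] of the two parts is cut by [U] into a clopen set. *)
have split_trivial A B : closed A -> closed B -> A `&` B = set0 ->
    Q = A `|` B -> A x -> B = set0.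
  move=> Acl Bcl AB0 QAB Ax.
  have AC : A `<=` C by move=> y Ay; apply: QC; rewrite QAB; left.
  have Ac : compact A by exact: (subclosed_compact Acl Cc).
  have [U [V [Uo Vo AU BV UV]]] := compact_closed_separate Ac Bcl AB0.
  have [K [Kx KC Kcl CKcl] KUV] : exists2 K, F K & K `<=` U `|` V.
    by apply: FQ; [exact: openU | rewrite QAB; exact: setUSS].
  have FKU : F (K `&` U).
    split; first by split=> //; exact: AU.
    - by move=> y [/KC].
    - suff -> : K `&` U = K `&` ~` V by apply: closedI => //; exact: open_closedC.
      apply/seteqP; split=> y [Ky]; last by case: (KUV _ Ky).
      by move=> Uy; split=> // Vy; rewrite -[False]/(set0 y) -UV.
    - suff -> : C `\` (K `&` U) = (C `\` K) `|` (C `&` ~` U).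
        by apply: closedU => //; apply: closedI => //; exact: open_closedC.
      by rewrite setDIr.
  apply/seteqP; split=> // y By.
  have Qy : Q y by rewrite QAB; right.
  have [_ Uy] := Qy _ FKU.
  by rewrite -UV; split=> //; exact: BV.
have Qconn : connected Q.
  move=> B [b Bb] [D Do BD] [E Ec BE].
  have Bcl : closed B by rewrite BE; exact: closedI.
  pose B' := Q `&` ~` D.
  have B'cl : closed B' by apply: closedI => //; exact: open_closedC.
  have BQ : B `<=` Q by rewrite BD => y [].
  have QBB' : Q = B `|` B' by rewrite BD -setIUr setUCr setIT.
  have BB'0 : B `&` B' = set0.
    by rewrite BD; apply/seteqP; split=> // y [[_ Dy] [_ nDy]].
  have [Bx|nBx] := pselect (B x).
    by rewrite QBB' (split_trivial B B') // setU0.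
  have B'x : B' x by move: Qx; rewrite {1}QBB' => -[].
  suff B0 : B = set0 by rewrite B0 in Bb.
  by apply: (split_trivial B' B) => //; [rewrite setIC | rewrite setUC].
have CoO : Q `<=` C^° `&` O.
  by move=> y /(connected_sub1 td Qconn Qx) ->; split.
have [K [Kx KC Kcl CKcl] KO] :=
  FQ _ (openI (@open_interior _ C) Oo) CoO.
exists K; split=> //; last by move=> y /KO[].
  suff -> : K = C^° `&` ~` (C `\` K).
    by apply: openI; [exact: open_interior | exact: closed_openC].
  apply/seteqP; split=> y.
    by move=> Ky; split; [case: (KO _ Ky) | case].
  move=> [/interior_subset Cy]; apply: contra_notP => nKy; exact: conj.
exact: (subclosed_compact Kcl Cc).
Qed.

Definition subgroup H := H 1%g /\ forall x y, H x -> H y -> H (x^-1 * y)%g.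

Lemma subgroupV H x : subgroup H -> H x -> H x^-1%g.
Proof. by move=> [H1 HM] Hx; rewrite -[(_^-1)%g]mulg1; exact: HM. Qed.

Lemma subgroupM H x y : subgroup H -> H x -> H y -> H (x * y)%g.
Proof.
by move=> sH Hx Hy; rewrite -(invgK x); apply: sH.2 => //; exact: subgroupV.
Qed.

Lemma subgroup_nbhs_open H : subgroup H -> nbhs 1%g H -> open H.
Proof.
move=> sH; rewrite nbhsE openE => -[U [Uo U1] UH] x Hx; rewrite /= /interior nbhsE.
exists [set y | U (x^-1 * y)%g]; last first.
  by move=> y /= /UH Hy; rewrite -(mulVKg x y); exact: subgroupM.
by split=> /=; [exact: open_translate | rewrite mulVg].
Qed.

Lemma subgroup_open_sub H U :
  subgroup H -> open U -> U 1%g -> U `<=` H -> open H.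
Proof.
move=> sH Uo U1 UH; apply: subgroup_nbhs_open => //.
by apply: filterS UH _; exact: open_nbhs_nbhs.
Qed.

Lemma open_subgroup_closed H : subgroup H -> open H -> closed H.
Proof.
move=> sH Ho; rewrite -[H]setCK; apply: open_closedC; rewrite openE => x nHx.
rewrite /interior nbhsE; exists [set y | H (x^-1 * y)%g].
  by split=> /=; [exact: open_translate | rewrite mulVg; exact: sH.1].
move=> y /= Hxy Hy; apply: nHx.
have -> : x = (y * (x^-1 * y)^-1)%g by rewrite invgM invgK mulVKg.
by apply: subgroupM => //; exact: subgroupV.
Qed.

Definition compact_open_subgroup U := [/\ subgroup U, open U & compact U].

(** The right translations preserving a compact open neighbourhood [K] of the
    identity form a subgroup inside [K], which is open by the tube lemma and
    therefore closed in [K]. *)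
Lemma van_dantzig H : locally_compact [set: G] -> totally_disconnected [set: G] ->
  open H -> H 1%g -> exists2 U, compact_open_subgroup U & U `<=` H.
Proof.
move=> lc td Ho H1.
have [B] := lc 1%g I; rewrite withinET => B1 [Bc Bcl].
have [K [K1 Ko Kc KH]] := clopen_base td Bc Bcl B1 Ho H1.
pose U := [set g | forall x, K (x * g)%g <-> K x].
have sU : subgroup U.
  split=> [x|x y Ux Uy z]; first by rewrite mulg1.
  by rewrite mulgA Uy -(Ux (z * x^-1)%g) mulgVK.
have UK : U `<=` K by move=> g Ug; rewrite -[g]mul1g; apply/Ug.
have W1 : nbhs (1%g : G) [set g | forall x, K x -> K (x * g)%g].
  have /compact_near_coveringP Kn := Kc.
  have := Kn _ (nbhs (1%g : G)) (fun g x => K (x * g)%g) _ _; apply.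
  move=> x Kx; apply: (@mulg_nbhs x 1%g K); rewrite mulg1.
  exact: open_nbhs_nbhs.
have Uo : open U.
  apply: subgroup_nbhs_open => //.
  have [O O1 OW] := nbhs_div W1; rewrite nbhsE; exists O => // g Og x.
  have O1' : O 1%g by case: O1.
  split=> [Kxg|]; last by have := OW _ _ Og O1'; rewrite invg1 mulg1; apply.
  by have := OW _ _ O1' Og _ Kxg; rewrite mul1g mulgK.
exists U; last exact: subset_trans KH.
split=> //; exact: (subclosed_compact (open_subgroup_closed sU Uo) Kc).
Qed.

Lemma compact_coset_cover V H : compact V -> subgroup H -> open H ->
  exists s : seq G, (forall g, g \in s -> V g) /\
    forall g, V g -> exists2 h, h \in s & H (h^-1 * g)%g.
Proof.
move=> Vc sH Ho.
pose cov (s : seq G) := [set g : G | exists2 h, h \in s & H (h^-1 * g)%g].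
have covo s : open (cov s).
  have -> : cov s = \bigcup_(h in [set h | h \in s]) [set g | H (h^-1 * g)%g] by [].
  by apply: bigcup_open => h _; exact: open_translate.
pose F := [set A | exists2 s : seq G, (forall g, g \in s -> V g) & A = ~` cov s].
have [||||A [s sV ->] As] := @compact_directed _ V F Vc.
- by exists (~` cov [::]), [::].
- by move=> A [s _ ->]; exact: open_closedC.
- move=> A B [s sV ->] [t tV ->]; exists (~` cov (s ++ t)).
    by exists (s ++ t) => // g; rewrite mem_cat => /orP[/sV|/tV].
  move=> g nst; split=> -[h hs Hh]; apply: nst; exists h => //.
    by rewrite mem_cat hs.
  by rewrite mem_cat hs orbT.
- move=> x Vx; exists (~` cov [:: x]).
    by exists [:: x] => // g; rewrite inE => /eqP ->.
  by apply; exists x; rewrite ?inE // mulVg; exact: sH.1.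
exists s; split=> // g Vg; apply: contrapT => nc.
by rewrite -[False]/(set0 g) -As.
Qed.

End TopologicalGroup.

(** * Rational vector spaces *)

Definition linear_map (V W : lmodType rat) (f : V -> W) of linear f : V -> W := f.
HB.instance Definition _ (V W : lmodType rat) (f : V -> W) (fl : linear f) :=
  GRing.isLinear.Build rat V W *:%R (linear_map fl) fl.
Arguments linear_map : simpl never.

Section Subspace.
Variables (V : lmodType rat) (S : set V).
Hypothesis sS : subspace_closed S.

Lemma subspace_zero : S 0. Proof. exact: sS.1. Qed.

Lemma subspace_add x y : S x -> S y -> S (x + y).
Proof. by move=> Sx Sy; rewrite -[x]scale1r; exact: sS.2. Qed.

Lemma subspace_scale a x : S x -> S (a *: x).
Proof.
by move=> Sx; rewrite -[_ *: _]addr0; apply: sS.2 => //; exact: subspace_zero.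
Qed.

Lemma subspace_opp x : S x -> S (- x).
Proof. by move=> Sx; rewrite -scaleN1r; exact: subspace_scale. Qed.

Lemma subspace_sub x y : S x -> S y -> S (x - y).
Proof. by move=> Sx Sy; apply: subspace_add => //; exact: subspace_opp. Qed.

Lemma subspace_sum (I : Type) (r : seq I) (P : pred I) (F : I -> V) :
  (forall i, P i -> S (F i)) -> S (\sum_(i <- r | P i) F i).
Proof.
move=> SF; elim/big_ind: _ => //; first exact: subspace_zero.
exact: subspace_add.
Qed.
End Subspace.

Lemma span_closed (V : lmodType rat) (X : set V) : subspace_closed (span X).
Proof.
split=> [S [S0 _] //|a x y Sx Sy S sS XS].
by apply: sS.2; [exact: Sx | exact: Sy].
Qed.

Lemma sub_span (V : lmodType rat) (X : set V) : X `<=` span X.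
Proof. by move=> x Xx S _; apply. Qed.

Lemma ker_closed (V W : lmodType rat) (f : V -> W) : linear f ->
  subspace_closed [set x | f x = 0].
Proof.
move=> fl; have f0 : f 0 = 0 by exact: (linear0 (linear_map fl)).
by split=> // a x y /= fx fy; rewrite fl fx fy scaler0 addr0.
Qed.

Lemma span_id (U : lmodType rat) (S : set U) : subspace_closed S -> span S = S.
Proof.
move=> sS; apply/seteqP; split=> [x|]; first exact.
exact: sub_span.
Qed.

Lemma qclass_eq0 (U : lmodType rat) (X : set U) x : qclass X x = 0 <-> span X x.
Proof. by rewrite -(linear0 (qclass X)) qclass_eq subr0. Qed.

Lemma linear_injective (U W : lmodType rat) (f : {linear U -> W}) :
  (forall x, f x = 0 -> x = 0) -> injective f.
Proof.
move=> f0 x y /eqP; rewrite -subr_eq0 -linearB => /eqP /f0 /eqP.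
by rewrite subr_eq0 => /eqP.
Qed.

(** * Homomorphisms *)

Section Morphisms.
Variable G : groupType.
Implicit Types M N P : lmodQG G.

HB.instance Definition _ M g :=
  GRing.isLinear.Build rat M M *:%R (lact g) (@lact_linear G M g).

Lemma lactK M g : cancel (@lact G M g) (lact g^-1%g).
Proof. by move=> x; rewrite -lactM mulVg lact1. Qed.

Lemma lactVK M g : cancel (@lact G M g^-1%g) (lact g).
Proof. by move=> x; rewrite -lactM mulgV lact1. Qed.

Definition make_lhom M N (f : M -> N) (fl : linear f)
  (f_act : forall g x, f (lact g x) = lact g (f x)) : lhom M N :=
  LHom f_act (lhom_fun := linear_map fl).

Definition lhom_id M : lhom M M :=
  @make_lhom M M id (fun _ _ _ => erefl) (fun _ _ => erefl).

Lemma lhom_comp_linear M N P (g : lhom N P) (f : lhom M N) : linear (g \o f).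
Proof. by move=> a x y /=; rewrite !linearP. Qed.

Lemma lhom_comp_act M N P (g : lhom N P) (f : lhom M N) h x :
  (g \o f) (lact h x) = lact h ((g \o f) x).
Proof. by rewrite /= !lhom_act. Qed.

Definition lhom_comp M N P (g : lhom N P) (f : lhom M N) : lhom M P :=
  make_lhom (lhom_comp_linear g f) (lhom_comp_act g f).

Lemma lhom_compE M N P (g : lhom N P) (f : lhom M N) x : lhom_comp g f x = g (f x).
Proof. by []. Qed.

Arguments make_lhom : simpl never.
Arguments lhom_comp : simpl never.
Arguments lhom_id : simpl never.

Lemma equalizer_closed M N (f h : lhom M N) : submodule_closed [set x | f x = h x].
Proof.
split=> [|g x /= fh]; last by rewrite !lhom_act fh.
by split=> /= [|a x y fx fy]; rewrite ?linear0 // !linearP fx fy.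
Qed.

Lemma range_closed M N (f : lhom M N) : submodule_closed (range f).
Proof.
split=> [|g _ [x _ <-]]; last by exists (lact g x) => //; rewrite lhom_act.
split=> [|a _ _ [x _ <-] [y _ <-]]; first by exists 0; rewrite ?linear0.
by exists (a *: x + y); rewrite ?linearP.
Qed.

Definition generates M (X : set M) :=
  forall S : set M, submodule_closed S -> X `<=` S -> S = setT.

Lemma lhom_ext M N (X : set M) (f h : lhom M N) :
  generates X -> (forall x, X x -> f x = h x) -> f =1 h.
Proof.
move=> gX fh x; suff : [set x | f x = h x] x by [].
by rewrite (gX _ (equalizer_closed f h)).
Qed.

End Morphisms.

(** * Discrete modules *)

Section Smooth.
Variable G : topologicalGroupType.
Implicit Types M N : lmodQG G.

Definition stab M (x : M) := [set g : G | lact g x = x].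

Lemma stab_subgroup M (x : M) : subgroup (stab x).
Proof.
split=> [|g h /= gx hx]; first exact: lact1.
by rewrite /stab /= lactM hx -{1}gx lactK.
Qed.

Lemma stab_all_subgroup M (X : set M) :
  subgroup [set g : G | forall x, X x -> lact g x = x].
Proof.
split=> [x _|g h gX hX x Xx]; first exact: lact1.
by apply: (stab_subgroup x).2; [exact: gX | exact: hX].
Qed.

Lemma stab_seq_open M (s : seq M) : (forall x, x \in s -> open (stab x)) ->
  open [set g : G | forall x, x \in s -> lact g x = x].
Proof.
elim: s => [|x s IHs] so.
  by rewrite (_ : [set _ | _] = setT); [exact: openT | apply/seteqP; split].
have -> : [set g : G | forall y, y \in x :: s -> lact g y = y] =
    stab x `&` [set g | forall y, y \in s -> lact g y = y].
  apply/seteqP; split=> [g gs|g [gx gs] y].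
    by split=> [|y ys]; apply: gs; rewrite inE ?eqxx ?ys ?orbT.
  by rewrite inE => /orP[/eqP ->|]; [exact: gx | exact: gs].
apply: openI; first by apply: so; rewrite inE eqxx.
by apply: IHs => y ys; apply: so; rewrite inE ys orbT.
Qed.

Lemma stab_act_open M (x : M) h : open (stab x) -> open (stab (lact h x)).
Proof.
move=> xo; have -> : stab (lact h x) = [set g | stab x (h^-1 * (g * h))%g].
  apply/seteqP; split=> g; rewrite /stab /= !lactM => gx.
    by rewrite gx lactK.
  by rewrite -{2}gx lactVK.
apply: (@open_rtranslate G h [set g | stab x (h^-1 * g)%g]).
exact: open_translate.
Qed.

Lemma smooth_closed M : submodule_closed [set x : M | open (stab x)].
Proof.
split=> [|h x]; last exact: stab_act_open.
split=> [|a x y /= xo yo].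
  rewrite /= (_ : stab 0 = setT); first exact: openT.
  by apply/seteqP; split=> // g _; rewrite /stab /= linear0.
apply: (@subgroup_open_sub G _ (stab x `&` stab y)); first exact: stab_subgroup.
- exact: openI.
- by split; exact: lact1.
- by move=> g [gx gy]; rewrite /stab /= linearP /= gx gy.
Qed.

Lemma generates_ldiscrete M (X : set M) :
  generates X -> (forall x, X x -> open (stab x)) -> ldiscrete M.
Proof.
move=> gX Xo x; suff : [set x : M | open (stab x)] x by [].
by rewrite (gX _ (smooth_closed M)).
Qed.

End Smooth.

(** * Averaging over a compact open subgroup *)

Section Average.
Variables (G : topologicalGroupType) (V : set G) (N : lmodQG G).
Hypotheses (coV : compact_open_subgroup V) (N_discrete : ldiscrete N).

Let sV : subgroup V. Proof. by case: coV. Qed.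

Definition fixed_by : set N := [set x | forall v, V v -> lact v x = x].

Definition coboundary : set N :=
  span [set x | exists v m, V v /\ x = lact v m - m].

(** Averaging is the projection along coboundaries. Characterising the average this
    way, rather than by a formula, makes it visibly linear and natural. *)
Definition is_average n x := fixed_by x /\ coboundary (n - x).

Lemma fixed_by_closed : subspace_closed fixed_by.
Proof.
split=> [v _|a x y xf yf v Vv]; first by rewrite linear0.
by rewrite linearP /= xf ?yf.
Qed.

Lemma coboundary_act v m : V v -> coboundary (lact v m - m).
Proof. by move=> Vv; apply: sub_span; exists v, m. Qed.

(** An open stabiliser makes the [V]-orbit finite, and its barycentre is the
    average. *)
Lemma average_exists n : exists x, is_average n x.
Proof.
have [_ _ Vc] := coV.
have [s [sV' sc]] := compact_coset_cover Vc (stab_subgroup n) (N_discrete n).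
pose O := undup [seq lact h n | h <- s].
have inO v : V v -> lact v n \in O.
  move=> /sc[h hs hv]; rewrite mem_undup; apply/mapP; exists h => //.
  by move: hv; rewrite /stab /= lactM => /(congr1 (lact h)); rewrite lactVK.
have Oin y : y \in O -> exists2 v, V v & y = lact v n.
  by rewrite mem_undup => /mapP[h /sV' Vh ->]; exists h.
have Oact v : V v -> perm_eq [seq lact v y | y <- O] O.
  move=> Vv; apply: uniq_perm; rewrite ?undup_uniq //.
    by rewrite map_inj_uniq ?undup_uniq //; exact: can_inj (lactK v).
  move=> y; apply/mapP/idP => [[z /Oin[u Vu ->] ->]|/Oin[u Vu ->]].
    by rewrite -lactM; apply: inO; exact: subgroupM.
  exists (lact v^-1%g (lact u n)); last by rewrite lactVK.
  by rewrite -lactM; apply: inO; exact: sV.2.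
have O0 : ((size O)%:R : rat) != 0.
  rewrite Num.Theory.pnatr_eq0 size_eq0; apply/eqP => O0.
  by have := inO 1%g sV.1; rewrite O0.
exists ((size O)%:R^-1 *: \sum_(y <- O) y); split=> [v Vv|].
  rewrite linearZ linear_sum /=; congr (_ *: _).
  by rewrite -[RHS](perm_big _ (Oact v Vv)) big_map.
have -> : n - (size O)%:R^-1 *: \sum_(y <- O) y =
    (size O)%:R^-1 *: \sum_(y <- O) (n - y).
  rewrite big_split /= sumrN scalerBr; congr (_ - _).
  by rewrite big_const_seq count_predT iter_addr_0 -scaler_nat scalerA mulVf ?scale1r.
apply: (subspace_scale (span_closed _)).
rewrite big_seq; apply: (subspace_sum (span_closed _)) => y /Oin[v Vv ->].
rewrite -opprB; apply: (subspace_opp (span_closed _)); exact: coboundary_act.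
Qed.

(** The list consists of representatives of [V] modulo the pointwise
    stabiliser [W] of the [V]-orbits of [ms]. As [W] is normal in [V], a right
    translation permutes the cosets, so the sum does not see it. *)
Lemma transversal_sum (ms : seq N) : exists s : seq G,
  [/\ s != [::], forall g, g \in s -> V g & forall v m, V v -> m \in ms ->
      \sum_(g <- s) lact g (lact v m) = \sum_(g <- s) lact g m].
Proof.
have [_ Vo Vc] := coV.
pose H := [set g : G | forall m, m \in ms -> lact g m = m].
have sH : subgroup H by exact: (stab_all_subgroup [set m | m \in ms]).
have Ho : open H by apply: stab_seq_open => m _; exact: N_discrete.
have [t [tV tc]] := compact_coset_cover Vc sH Ho.
pose X := [set x : N | exists v m, [/\ V v, m \in ms & x = lact v m]].
pose W := V `&` [set g : G | forall x, X x -> lact g x = x].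
have sW : subgroup W.
  have [s1 s2] := stab_all_subgroup X.
  split=> [|x y [Vx Xx] [Vy Xy]]; first by split=> //; exact: sV.1.
  by split; [exact: sV.2 | exact: s2].
have Wo : open W.
  pose xs := [seq lact h m | h <- t, m <- ms].
  apply: (@subgroup_open_sub G W
    (V `&` [set g : G | forall x, x \in xs -> lact g x = x])) => //.
  - by apply: openI => //; apply: stab_seq_open => x _; exact: N_discrete.
  - by split; [exact: sV.1 | move=> x _; exact: lact1].
  move=> g [Vg gx]; split=> // _ [v [m [Vv mms ->]]].
  have [h ht /(_ m mms) hv] := tc v Vv.
  have -> : lact v m = lact h m.
    by rewrite -{2}hv -lactM mulVKg.
  by apply: gx; apply/allpairsP; exists (h, m).
have WJ g v : V v -> W g -> W (v^-1 * (g * v))%g.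
  move=> Vv [Vg gX]; split; first by apply: sV.2 => //; exact: subgroupM.
  move=> _ [u [m [Vu mms ->]]].
  have gvu : lact g (lact v (lact u m)) = lact v (lact u m).
    rewrite -[lact v _]lactM; apply: gX; exists (v * u)%g, m; split=> //.
    exact: subgroupM.
  by rewrite !lactM gvu lactK.
have [t' [t'V t'c]] := compact_coset_cover Vc sW Wo.
(* [r g] is the first member of [t'] in the coset [g W]. *)
pose inW g : pred G := fun h => `[< W (h^-1 * g)%g >].
pose r g := nth 1%g t' (find (inW g) t').
have hasr g : V g -> has (inW g) t'.
  by move=> /t'c[h ht hW]; apply/hasP; exists h => //; exact/asboolP.
have rW g : V g -> W ((r g)^-1 * g)%g.
  by move=> /hasr /(nth_find 1%g) /asboolP.
have rt g : V g -> r g \in t' by move=> /hasr gt; rewrite mem_nth // -has_find.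
have rV g : V g -> V (r g) by move=> /rt /t'V.
have req g h : W (g^-1 * h)%g -> r g = r h.
  move=> gh; suff e : inW g =1 inW h by rewrite /r (eq_find e).
  move=> k; apply/asboolP/asboolP => kg.
    by have := subgroupM sW kg gh; rewrite mulgA mulgK.
  by have := subgroupM sW kg (subgroupV sW gh); rewrite invgM invgK mulgA mulgK.
have rr g : V g -> r (r g) = r g by move=> Vg; exact: req (rW _ Vg).
pose s := undup [seq r h | h <- t'].
have sP g : reflect (V g /\ r g = g) (g \in s).
  rewrite mem_undup; apply: (iffP mapP) => [[h /t'V Vh ->]|[Vg rg]].
    by split; [exact: rV | exact: rr].
  by exists g => //; rewrite -rg; exact: rt.
exists s; split=> [||v m Vv mms].
- have : r 1%g \in s by apply/sP; split; [exact/rV/sV.1 | exact/rr/sV.1].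
  by case: s {sP}.
- by move=> g /sP[].
have sv g : V g -> lact g (lact v m) = lact (r (g * v)%g) m.
  move=> Vg; have Vgv := subgroupM sV Vg Vv.
  have gvm : lact ((r (g * v))^-1 * (g * v))%g m = m.
    apply: (rW _ Vgv).2; exists 1%g, m; rewrite lact1; split=> //; exact: sV.1.
  by rewrite -[in RHS]gvm -!lactM mulVKg.
have perm : perm_eq [seq r (g * v)%g | g <- s] s.
  have us : uniq s by exact: undup_uniq.
  have um : uniq [seq r (g * v)%g | g <- s].
    rewrite map_inj_in_uniq // => g h /sP[Vg rg] /sP[Vh rh] e.
    rewrite -rg -rh; apply: req.
    have := subgroupM sW (subgroupV sW (rW _ (subgroupM sV Vg Vv)))
      (rW _ (subgroupM sV Vh Vv)).
    rewrite e invgM invgK mulgA mulgK invgM => /(WJ _ v^-1%g (subgroupV sV Vv)).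
    by rewrite invgK !mulgA mulgV mul1g mulgK.
  apply: uniq_perm => //.
  have ss : {subset [seq r (g * v)%g | g <- s] <= s}.
    move=> _ /mapP[g /sP[Vg _] ->]; apply/sP.
    by have Vgv := subgroupM sV Vg Vv; split; [exact: rV | exact: rr].
  by apply: (uniq_min_size um ss _).2; rewrite size_map.
rewrite -[RHS](perm_big _ perm) big_map big_seq [RHS]big_seq.
by apply: eq_bigr => g /sP[Vg _]; exact: sv.
Qed.

(** The sum over a transversal multiplies a fixed vector by a nonzero integer, but it
    kills coboundaries. *)
Lemma fixed_coboundary_eq0 z : fixed_by z -> coboundary z -> z = 0.
Proof.
move=> zf zc.
pose good (ms : seq N) (s : seq G) := [/\ s != [::], forall g, g \in s -> V g
  & forall v m, V v -> m \in ms ->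
      \sum_(g <- s) lact g (lact v m) = \sum_(g <- s) lact g m].
pose S := [set x : N | exists ms, forall s, good ms s ->
  \sum_(g <- s) lact g x = 0].
have sS : subspace_closed S.
  split=> [|a x y [ms xS] [ns yS]].
    by exists [::] => s _; rewrite big1 // => g _; rewrite linear0.
  exists (ms ++ ns) => s [s0 sVs ss].
  under eq_bigr do rewrite linearP.
  rewrite big_split -scaler_sumr /= xS ?yS ?scaler0 ?addr0 //.
    by split=> // v m Vv mm; apply: ss => //; rewrite mem_cat mm orbT.
  by split=> // v m Vv mm; apply: ss => //; rewrite mem_cat mm.
have [|ms zS] := zc S sS.
  move=> _ [v [m [Vv ->]]]; exists [:: m] => s [_ _ ss].
  under eq_bigr do rewrite linearB.
  by rewrite sumrB ss ?inE ?eqxx // subrr.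
have [s sgood] := transversal_sum ms; have [s0 sVs _] := sgood.
have := zS s sgood; rewrite big_seq (eq_bigr (fun=> z)); last first.
  by move=> g /sVs Vg; exact: zf.
rewrite -big_seq big_const_seq count_predT iter_addr_0 -scaler_nat => /eqP.
by rewrite scaler_eq0 Num.Theory.pnatr_eq0 size_eq0 (negPf s0) => /eqP.
Qed.

Definition average n : N := xget 0 [set x | is_average n x].

Lemma averageP n : is_average n (average n).
Proof. by have [x nx] := average_exists n; rewrite /average; case: xgetP => // /(_ x). Qed.

Lemma average_fixed n v : V v -> lact v (average n) = average n.
Proof. by case: (averageP n) => + _; exact. Qed.

Lemma average_coboundary n : coboundary (n - average n).
Proof. by case: (averageP n). Qed.

Lemma average_unique n x : fixed_by x -> coboundary (n - x) -> average n = x.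
Proof.
move=> xf nx; have [nf na] := averageP n; apply/eqP; rewrite -subr_eq0; apply/eqP.
apply: fixed_coboundary_eq0; first exact: (subspace_sub fixed_by_closed).
have -> : average n - x = (n - x) - (n - average n).
  by rewrite opprB [RHS]addrC subrKA.
exact: (subspace_sub (span_closed _)).
Qed.

Lemma average_id n : fixed_by n -> average n = n.
Proof.
by move=> nf; apply: average_unique => //; rewrite subrr; exact: (span_closed _).1.
Qed.

Lemma average_act v n : V v -> average (lact v n) = average n.
Proof.
move=> Vv; apply: average_unique; first exact: average_fixed.
rewrite -(subrKA n); apply: (subspace_add (span_closed _)).
  exact: coboundary_act.
exact: average_coboundary.
Qed.

Lemma average_linear : linear average.
Proof.
move=> a x y; apply: average_unique.
  by apply: fixed_by_closed.2 => v; exact: average_fixed.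
rewrite opprD addrACA -scalerBr; apply: (span_closed _).2; exact: average_coboundary.
Qed.

HB.instance Definition _ := GRing.isLinear.Build rat N N *:%R average average_linear.

(** Such a map kills coboundaries. *)
Lemma average_invariant (W : lmodType rat) (f : N -> W) n : linear f ->
  (forall v m, V v -> f (lact v m) = f m) -> f (average n) = f n.
Proof.
move=> fl fV; have [F FE] : exists F : {linear N -> W}, F =1 f.
  by exists (linear_map fl).
rewrite -!FE; apply/esym/eqP; rewrite -subr_eq0 -linearB; apply/eqP.
have /(_ [set x | F x = 0]) := average_coboundary n; apply.
  by apply: ker_closed; exact: linearP.
move=> _ [v [m [Vv ->]]] /=; apply/eqP.
by rewrite linearB subr_eq0 !FE fV.
Qed.

End Average.

Lemma average_lhom (G : topologicalGroupType) (V : set G) (M N : lmodQG G)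
    (f : lhom M N) m :
  compact_open_subgroup V -> ldiscrete M -> ldiscrete N ->
  f (average V m) = average V (f m).
Proof.
move=> coV dM dN; apply/esym/average_unique => // [v Vv|].
  by rewrite -lhom_act average_fixed.
rewrite -linearB => S sS XS.
have /(_ (f @^-1` S)) := average_coboundary coV dM m; apply.
  split=> [|a x y Sx Sy]; first by rewrite /preimage /= linear0; exact: sS.1.
  by rewrite /preimage /= linearP; exact: sS.2.
move=> _ [v [x [Vv ->]]]; apply: XS; exists v, (f x); split=> //.
by rewrite linearB /= lhom_act.
Qed.

(** * Permutation modules *)

Section FreeModule.
Variable K : choiceType.

Notation gen k := (<< 1 *g k >> : {malg rat[K]}).

Lemma malg_ind (S : set {malg rat[K]}) : subspace_closed S ->
  (forall k, S (gen k)) -> forall x, S x.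
Proof.
move=> sS Sk x; rewrite (monalgE x); apply: (subspace_sum sS) => k _.
suff -> : << x@_k *g k >> = x@_k *: gen k by exact: subspace_scale.
by apply/malgP => j; rewrite mcoeffZ !mcoeffU mulrnAr mulr1.
Qed.

Lemma linear_malg_ext (W : lmodType rat) (f h : {linear {malg rat[K]} -> W}) :
  (forall k, f (gen k) = h (gen k)) -> f =1 h.
Proof.
move=> fh x; apply: (malg_ind (S := [set x | f x = h x])) => //=.
by split=> /= [|a y z fy fz]; rewrite ?linear0 // !linearP /= fy fz.
Qed.

End FreeModule.

Section PermutationModule.
Variables (G : groupType) (W : gSet G).

Notation gen w := (<< 1 *g w >> : {malg rat[W]}).

Definition perm_act (g : G) : {malg rat[W]} -> {malg rat[W]} :=
  free_lift (fun w => gen (gact g w)).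

HB.instance Definition _ g := GRing.Linear.on (perm_act g).

Lemma perm_actU g w : perm_act g (gen w) = gen (gact g w).
Proof. exact: free_liftU. Qed.

Lemma perm_act_linear g : linear (perm_act g).
Proof. exact: linearP. Qed.

Lemma perm_act1 x : perm_act 1%g x = x.
Proof.
apply: (linear_malg_ext (f := perm_act 1%g) (h := idfun)) => w.
by rewrite /= perm_actU gact1.
Qed.

Lemma perm_actM g h x : perm_act (g * h)%g x = perm_act g (perm_act h x).
Proof.
apply: (linear_malg_ext (f := perm_act (g * h)%g) (h := perm_act g \o perm_act h)) => w.
by rewrite /= !perm_actU gactM.
Qed.

Definition permutation_module : lmodQG G :=
  LmodQG perm_act_linear perm_act1 perm_actM.

Definition basis_elt (w : W) : permutation_module := gen w.

Lemma basis_elt_act g w : basis_elt (gact g w) = lact g (basis_elt w).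
Proof. by rewrite /basis_elt -perm_actU. Qed.

Lemma permutation_module_free : freely_spanned_by basis_elt.
Proof.
split=> [|x|s c us s0 w ws]; first exact: basis_elt_act.
  exists (msupp (x : {malg rat[W]})), (fun w => (x : {malg rat[W]})@_w).
  rewrite {1}(monalgE x); apply: eq_bigr => w _.
  by apply/malgP => j; rewrite mcoeffZ !mcoeffU mulrnAr mulr1.
have := congr1 (mcoeff w) s0; rewrite mcoeff0 => <-.
rewrite raddf_sum /= (bigD1_seq w) //= mcoeffZ mcoeffUU mulr1 big1 ?addr0 //.
by move=> v /negPf vw; rewrite mcoeffZ mcoeffU vw mulr0.
Qed.

Section Lift.
Variables (N : lmodQG G) (h : W -> N).
Hypothesis h_act : forall g w, h (gact g w) = lact g (h w).

Lemma free_lift_act g (x : permutation_module) :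
  free_lift h (lact g x) = lact g (free_lift h x).
Proof.
apply: (linear_malg_ext (f := free_lift h \o perm_act g) (h := lact g \o free_lift h)) => w.
by rewrite /= perm_actU !free_liftU h_act.
Qed.

Definition perm_lift : lhom permutation_module N :=
  @make_lhom _ permutation_module N _ (free_lift_is_linear h) free_lift_act.

Lemma perm_liftE w : perm_lift (basis_elt w) = h w.
Proof. exact: free_liftU. Qed.
End Lift.

Lemma permutation_module_generates (X : set permutation_module) :
  (forall w, exists g x, X x /\ basis_elt w = lact g x) -> generates X.
Proof.
move=> Xw S [sS Sact] XS; apply/seteqP; split=> // x _.
apply: malg_ind => // w; have [g [y [/XS Sy wy]]] := Xw w.
by rewrite -[<< _ *g _ >>]/(basis_elt w) wy; exact: Sact.
Qed.

End PermutationModule.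

Section StandardModule.
Variable G : topologicalGroupType.

Record cosubgroup :=
  CoSubgroup { cosub :> set G; cosubP : compact_open_subgroup cosub }.

Lemma cosub_subgroup (U : cosubgroup) : subgroup U.
Proof. by case: (cosubP U). Qed.

Variables (n : nat) (V : 'I_n -> cosubgroup).

Definition coset_rel (p q : 'I_n * G) :=
  (p.1 == q.1) && `[< cosub (V p.1) (p.2^-1 * q.2)%g >].

Lemma coset_relP p q :
  reflect (p.1 = q.1 /\ cosub (V p.1) (p.2^-1 * q.2)%g) (coset_rel p q).
Proof.
by apply: (iffP andP) => -[/eqP pq /asboolP Vpq].
Qed.

Lemma coset_rel_refl : reflexive coset_rel.
Proof.
by move=> p; apply/coset_relP; rewrite mulVg; split=> //; exact: (cosub_subgroup _).1.
Qed.

Lemma coset_rel_sym : symmetric coset_rel.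
Proof.
suff h p q : coset_rel p q -> coset_rel q p by move=> p q; apply/idP/idP; exact: h.
move=> /coset_relP[e Vpq]; apply/coset_relP; rewrite -e; split=> //.
by have := subgroupV (cosub_subgroup _) Vpq; rewrite invgM invgK.
Qed.

Lemma coset_rel_trans : transitive coset_rel.
Proof.
move=> q p r /coset_relP[epq Vpq] /coset_relP[eqr Vqr].
apply/coset_relP; rewrite epq in Vpq *; split=> //.
by have := subgroupM (cosub_subgroup _) Vpq Vqr; rewrite mulgA mulgK.
Qed.

Canonical coset_equiv :=
  EquivRel coset_rel coset_rel_refl coset_rel_sym coset_rel_trans.

(** The disjoint union of the coset spaces G/V_k. *)
Definition coset_sum := {eq_quot coset_equiv}%qT.
HB.instance Definition _ := Choice.on coset_sum.

Definition coset_of (p : 'I_n * G) : coset_sum := \pi_({eq_quot coset_equiv})%qT p.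

Lemma coset_ofP p q :
  coset_of p = coset_of q <-> p.1 = q.1 /\ cosub (V p.1) (p.2^-1 * q.2)%g.
Proof.
split=> [/eqmodP/coset_relP //|pq]; apply/eqmodP; exact/coset_relP.
Qed.

Lemma coset_ofW (w : coset_sum) : exists k g, w = coset_of (k, g).
Proof.
exists (repr w).1, (repr w).2; rewrite -surjective_pairing; exact/esym/reprK.
Qed.

Definition coset_act (g : G) (w : coset_sum) :=
  coset_of ((repr w).1, g * (repr w).2)%g.

Lemma coset_actE g k h : coset_act g (coset_of (k, h)) = coset_of (k, g * h)%g.
Proof.
apply/coset_ofP => /=.
have /coset_ofP[/= e Vh] : coset_of (repr (coset_of (k, h))) = coset_of (k, h).
  exact: reprK.
by split=> //; rewrite invgM mulgA mulgVK.
Qed.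

Lemma coset_act1 w : coset_act 1%g w = w.
Proof. by have [k [g ->]] := coset_ofW w; rewrite coset_actE mul1g. Qed.

Lemma coset_actM g h w : coset_act (g * h)%g w = coset_act g (coset_act h w).
Proof. by have [k [x ->]] := coset_ofW w; rewrite !coset_actE mulgA. Qed.

Definition coset_gSet := GSet coset_act1 coset_actM.

(** The direct sum of the modules Q[G/V_k]. *)
Definition coset_module : lmodQG G := permutation_module coset_gSet.

Definition coset_gen (k : 'I_n) : coset_module := basis_elt (coset_of (k, 1%g) : coset_gSet).

Lemma coset_module_gen_act k g :
  basis_elt (coset_of (k, g) : coset_gSet) = lact g (coset_gen k).
Proof. by rewrite /coset_gen -basis_elt_act /= coset_actE mulg1. Qed.

Lemma coset_module_gen_fixed k g : cosub (V k) g -> lact g (coset_gen k) = coset_gen k.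
Proof.
move=> Vg; rewrite -coset_module_gen_act; congr basis_elt; apply/coset_ofP => /=.
by split=> //; rewrite mulg1; apply: subgroupV => //; exact: cosub_subgroup.
Qed.

Lemma coset_module_generated : generates (range coset_gen).
Proof.
apply: permutation_module_generates => w; have [k [g ->]] := coset_ofW w.
by exists g, (coset_gen k); split; [exists k | exact: coset_module_gen_act].
Qed.

Lemma coset_module_ind (S : set coset_module) : subspace_closed S ->
  (forall k g, S (lact g (coset_gen k))) -> forall x, S x.
Proof.
move=> sS Sk; apply: malg_ind => // w; have [k [g ->]] := coset_ofW w.
by rewrite -[<< _ *g _ >>]/(basis_elt _) coset_module_gen_act.
Qed.

Lemma coset_module_lift_exists (N : lmodQG G) (x : 'I_n -> N) :
  (forall k, fixed_by (V k) (x k)) ->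
  exists f : lhom coset_module N, forall k, f (coset_gen k) = x k.
Proof.
move=> xf; pose h (w : coset_gSet) := lact (repr w).2 (x (repr w).1).
have hE k g : h (coset_of (k, g)) = lact g (x k).
  have /coset_ofP[/= e Vg] : coset_of (repr (coset_of (k, g))) = coset_of (k, g).
    exact: reprK.
  rewrite e in Vg; rewrite /h e -[in LHS](xf k _ Vg) -lactM mulVKg //.
have h_act g (w : coset_gSet) : h (gact g w) = lact g (h w).
  by have [k [y ->]] := coset_ofW w; rewrite /= coset_actE !hE lactM.
by exists (perm_lift h_act) => k; rewrite perm_liftE hE lact1.
Qed.

Definition coset_module_lift (N : lmodQG G) (x : 'I_n -> N)
  (xf : forall k, fixed_by (V k) (x k)) : lhom coset_module N :=
  projT1 (cid (coset_module_lift_exists xf)).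

Lemma coset_module_liftE (N : lmodQG G) (x : 'I_n -> N)
    (xf : forall k, fixed_by (V k) (x k)) k :
  coset_module_lift xf (coset_gen k) = x k.
Proof. exact: (projT2 (cid (coset_module_lift_exists xf))). Qed.

Lemma coset_module_fg_proper : fg_proper_permutation coset_module.
Proof.
split; last first.
  exists (codom coset_gen) => S sS Sk; apply: coset_module_generated => // _ [k _ <-].
  by apply: Sk; exact: codom_f.
exists coset_gSet, (@basis_elt _ _); split; first exact: permutation_module_free.
move=> w; have [k [g ->]] := coset_ofW w.
have [_ Vo Vc] := cosubP (V k).
have -> : [set h | @gact _ coset_gSet h (coset_of (k, g)) = coset_of (k, g)] =
    [set h | cosub (V k) (g^-1 * (h * g))%g].
  apply/seteqP; split=> h /=.
    by rewrite coset_actE => /esym /coset_ofP /= [].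
  by move=> Vh; rewrite coset_actE; apply/esym/coset_ofP.
split.
  apply: (@open_rtranslate G g [set h | cosub (V k) (g^-1 * h)%g]).
  exact: open_translate.
have -> : [set h | cosub (V k) (g^-1 * (h * g))%g] =
    (fun h => g * h * g^-1)%g @` cosub (V k).
  apply/seteqP; split=> [h /= Vh|_ [h Vh <-] /=].
    by exists (g^-1 * (h * g))%g => //; rewrite mulVKg mulgK.
  by rewrite mulgVK mulgA mulVg mul1g.
apply: continuous_compact => //; apply: continuous_subspaceT => h.
move=> A /= ghA.
have oi B : nbhs (g * h / g)%g B -> nbhs h [set x | B (g * x / g)%g].
  rewrite nbhsE => -[U [Uo Uh] UB]; rewrite nbhsE.
  exists [set x | U (g * x / g)%g]; last by move=> x /= /UB.
  split=> //.
  apply: (@open_translate G g [set x | U (x / g)%g]); exact: open_rtranslate.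
exact: oi.
Qed.

Lemma coset_module_ldiscrete : ldiscrete coset_module.
Proof.
apply: generates_ldiscrete coset_module_generated _ => _ [k _ <-].
have [sV Vo _] := cosubP (V k).
have sS := stab_subgroup (coset_gen k); apply: (subgroup_open_sub sS Vo sV.1).
by move=> g Vg; exact: coset_module_gen_fixed.
Qed.

End StandardModule.
Global Opaque coset_module coset_gen.

Lemma lhom_inverse (G : groupType) (M N : lmodQG G) (f : lhom M N) :
  injective f -> (forall y, exists x, f x = y) ->
  exists h : lhom N M, cancel h f.
Proof.
move=> fI fS; pose h y := projT1 (cid (fS y)).
have hK : cancel h f by move=> y; exact: projT2 (cid (fS y)).
have hl : linear h by move=> a x y; apply: fI; rewrite linearP !hK.
have ha g x : h (lact g x) = lact g (h x) by apply: fI; rewrite lhom_act !hK.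
by exists (make_lhom hl ha).
Qed.

Lemma perm_act_coeff (G : groupType) (W : gSet G) g (z : permutation_module W) w :
  (lact g z : {malg rat[W]})@_w = (z : {malg rat[W]})@_(gact g^-1%g w).
Proof.
apply: (malg_ind (S := [set z | (perm_act g z)@_w = z@_(gact g^-1%g w)])) => [|v].
  split=> [|a x y /= xw yw]; first by rewrite /= linear0 !mcoeff0.
  by rewrite /= linearP !mcoeffD !mcoeffZ /= xw yw.
rewrite /= perm_actU !mcoeffU; congr (_ *+ _).
have -> : (gact g v == w) = (v == gact g^-1%g w) by
  apply/eqP/eqP => [<-|->]; rewrite -gactM ?mulVg ?mulgV gact1.
by [].
Qed.

(** List points of the basis that meet every orbit. A basis vector [g v], with [v] the
    first listed point of its orbit, goes to the coset of [g] in the summand of [v].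
    Taking a retract rather than an isomorphism, several listed points may share an orbit. *)
Lemma fg_proper_retract (G : topologicalGroupType) (P : lmodQG G) :
  fg_proper_permutation P ->
  exists n (V : 'I_n -> cosubgroup G) (p : lhom (coset_module V) P)
      (s : lhom P (coset_module V)),
    cancel s p.
Proof.
move=> [[W [e [[e_act e_span e_free] Wst]]] [s Ps]].
pose phi := perm_lift e_act.
have phiI : injective phi.
  move=> x y /eqP; rewrite -subr_eq0 -linearB => /eqP.
  set z : {malg rat[W]} := x - y => z0; apply/eqP; rewrite -subr_eq0; apply/eqP.
  rewrite -/z; apply/malgP => w; rewrite mcoeff0.
  have [ws|/mcoeff_outdom //] := boolP (w \in msupp z).
  exact: (e_free (msupp z) (fun w => z@_w) (fset_uniq _) z0).
have phiS x : exists z, phi z = x.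
  have [t [c ->]] := e_span x.
  exists (\sum_(w <- t) c w *: basis_elt w).
  by rewrite linear_sum; apply: eq_bigr => w _; rewrite linearZ /= perm_liftE.
have [psi psiK] := lhom_inverse phiI phiS.
pose l : seq W := flatten [seq enum_fset (msupp (psi y : {malg rat[W]})) | y <- s].
pose orb w := exists2 v, v \in l & exists g, w = gact g v.
(* The vectors supported on the orbits of [l] form a submodule that contains the
   generators. *)
have orbP w : orb w.
  pose S := phi @` [set z | forall w, ~ orb w -> (z : {malg rat[W]})@_w = 0].
  have sS : submodule_closed S.
    split=> [|g _ [z zo <-]].
      split; first by exists 0; rewrite ?linear0 // => v _; rewrite mcoeff0.
      move=> a _ _ [y yo <-] [z zo <-]; exists (a *: y + z); last by rewrite linearP.
      by move=> v nv; rewrite mcoeffD mcoeffZ yo // zo // mulr0 addr0.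
    exists (lact g (z : permutation_module W)); last exact: lhom_act.
    move=> v nv; rewrite perm_act_coeff zo // => -[u ul [h vh]]; apply: nv.
    by exists u => //; exists (g * h)%g; rewrite gactM -vh -gactM mulgV gact1.
  have : S (e w).
    rewrite (Ps S sS) // => y ys; exists (psi y) => // v nv; apply: mcoeff_outdom.
    apply/negP => vy; apply: nv; exists v; last by exists 1%g; rewrite gact1.
    by apply/flattenP; exists (enum_fset (msupp (psi y : {malg rat[W]}))) => //; exact: map_f.
  move=> [z zo]; rewrite -(perm_liftE e_act) => /phiI zw.
  apply: contrapT => /zo; rewrite zw mcoeffUU => /eqP; exact/negP/oner_neq0.
pose v (k : 'I_(size l)) := tnth (in_tuple l) k.
have coV k : compact_open_subgroup [set g : G | gact g (v k) = v k].
  split; [|exact: (Wst _).1|exact: (Wst _).2].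
  split=> [|g h /= gv hv]; first exact: gact1.
  by rewrite gactM hv -{1}gv -gactM mulVg gact1.
pose V k := CoSubgroup (coV k).
pose hits w k := `[< exists g, w = gact g (v k) >].
have idx_exists w : exists k, hits w k.
  have [u ul [g wg]] := orbP w; have /tnthP[k uk] : u \in in_tuple l by [].
  by exists k; apply/asboolP; exists g; rewrite /v -uk.
(* The choice depends only on the orbit of [w], since [hits w] does. *)
pose idx w := xchoose (idx_exists w).
have idxP w : exists g, w = gact g (v (idx w)) by apply/asboolP/(xchooseP (idx_exists w)).
have idx_act g w : idx (gact g w) = idx w.
  apply: eq_xchoose => k; apply/asboolP/asboolP => -[h wh].
    by exists (g^-1 * h)%g; rewrite gactM -wh -gactM mulVg gact1.
  by exists (g * h)%g; rewrite gactM -wh.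
pose tr w := projT1 (cid (idxP w)).
have trP w : gact (tr w) (v (idx w)) = w by exact/esym/(projT2 (cid (idxP w))).
pose h w := lact (tr w) (coset_gen V (idx w)).
have h_act g w : h (gact g w) = lact g (h w).
  have fx : gact ((g * tr w)^-1 * tr (gact g w))%g (v (idx w)) = v (idx w).
    have gw : gact (tr (gact g w)) (v (idx w)) = gact g w.
      by rewrite -(idx_act g w) trP.
    have gw' : gact g w = gact (g * tr w)%g (v (idx w)) by rewrite gactM trP.
    by rewrite gactM gw gw' -gactM mulVg gact1.
  rewrite /h idx_act -lactM -[in RHS](@coset_module_gen_fixed _ _ V _ _ fx).
  by rewrite -lactM mulVKg.
have ef k : fixed_by (V k) (e (v k)) by move=> g Vg; rewrite -e_act Vg.
pose p := coset_module_lift ef.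
exists (size l), V, p, (lhom_comp (perm_lift h_act) psi) => x.
rewrite -{2}(psiK x) /=.
suff pe : lhom_comp p (perm_lift h_act) =1 phi by exact: pe.
apply: (lhom_ext (X := range (@basis_elt G W))).
  apply: permutation_module_generates => w; exists 1%g, (basis_elt w).
  by rewrite lact1; split=> //; exists w.
move=> _ [w _ <-]; rewrite lhom_compE !perm_liftE /h lhom_act coset_module_liftE -e_act.
by rewrite trP.
Qed.

(** * Left and right modules *)

Section Opposite.
Variable G : groupType.

Section OppositeLeft.
Variable M : lmodQG G.
Definition op_ract (x : M) (g : G) := lact g^-1%g x.
Lemma op_ract_linear g : linear (op_ract^~ g).
Proof. by move=> a x y; rewrite /op_ract linearP. Qed.
Lemma op_ract1 x : op_ract x 1%g = x.
Proof. by rewrite /op_ract invg1 lact1. Qed.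
Lemma op_ractM x g h : op_ract x (g * h)%g = op_ract (op_ract x g) h.
Proof. by rewrite /op_ract invgM lactM. Qed.
Definition right_of_left : rmodQG G := RmodQG op_ract_linear op_ract1 op_ractM.
End OppositeLeft.

Section OppositeRight.
Variable A : rmodQG G.
Definition op_lact (g : G) (x : A) := ract x g^-1%g.
Lemma op_lact_linear g : linear (op_lact g).
Proof. exact: ract_linear. Qed.
Lemma op_lact1 x : op_lact 1%g x = x.
Proof. by rewrite /op_lact invg1 ract1. Qed.
Lemma op_lactM g h x : op_lact (g * h)%g x = op_lact g (op_lact h x).
Proof. by rewrite /op_lact invgM ractM. Qed.
Definition left_of_right : lmodQG G := LmodQG op_lact_linear op_lact1 op_lactM.
End OppositeRight.

Definition rhom_of_lhom (M N : lmodQG G) (f : lhom M N) :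
    rhom (right_of_left M) (right_of_left N) :=
  @RHom G (right_of_left M) (right_of_left N) (lhom_fun f)
    (fun x g => lhom_act f g^-1%g x).

End Opposite.

Lemma left_of_right_discrete (G : topologicalGroupType) (A : rmodQG G) :
  rdiscrete A -> ldiscrete (left_of_right A).
Proof.
move=> dA x; have -> : [set g | @lact _ (left_of_right A) g x = x] =
    [set g | ract x g = x]; last exact: dA.
apply/seteqP; split=> g /= gx.
  by rewrite -{1}gx /= /op_lact -ractM mulVg ract1.
by rewrite /op_lact -{1}gx -ractM mulgV ract1.
Qed.

Lemma right_of_left_discrete (G : topologicalGroupType) (M : lmodQG G) :
  ldiscrete M -> rdiscrete (right_of_left M).
Proof.
move=> dM x; have -> : [set g | @ract _ (right_of_left M) x g = x] =
    [set g | lact g x = x]; last exact: dM.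
apply/seteqP; split=> g /= gx.
  by rewrite -{1}gx lactVK.
by rewrite /op_ract -{1}gx lactK.
Qed.

(** * The pairing with a coset module *)

Section Pairing.
Variables (G : topologicalGroupType) (n : nat) (V : 'I_n -> cosubgroup G).

Section FunctionModule.
Variable N : lmodQG G.
(** Maps out of the coset module into this module are pairings that are
    invariant under the diagonal action of [G]. *)
Definition fun_act (g : G) (T : N -> N) : N -> N := fun x => T (lact g^-1%g x).
Lemma fun_act_linear g : linear (fun_act g).
Proof. by move=> a S T; apply/funext => x. Qed.
Lemma fun_act1 T : fun_act 1%g T = T.
Proof. by apply/funext => x; rewrite /fun_act invg1 lact1. Qed.
Lemma fun_actM g h T : fun_act (g * h)%g T = fun_act g (fun_act h T).
Proof. by apply/funext => x; rewrite /fun_act invgM lactM. Qed.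
Definition fun_module : lmodQG G := LmodQG fun_act_linear fun_act1 fun_actM.
End FunctionModule.

Lemma pairing_exists (N : lmodQG G) (dN : ldiscrete N) (k : 'I_n) :
  exists f : lhom (coset_module V) (fun_module N), forall j,
    f (coset_gen V j) = if j == k then (@average _ (V k) N) else 0.
Proof.
apply: coset_module_lift_exists => j v; case: eqP => [->|_] Vv; last exact: linear0.
apply/funext => x; rewrite /= /fun_act average_act //; first exact: cosubP.
by apply: subgroupV => //; exact: cosub_subgroup.
Qed.

Variables (N : lmodQG G) (dN : ldiscrete N).

(** The invariant pairing for which [pairing k w_j] is the average over V_k when
    [j = k] and zero otherwise. Together these identify the tensor product of the coset module,
    turned into a right module, with the sum of the V_k-fixed points. *)
Definition pairing k : lhom (coset_module V) (fun_module N) :=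
  projT1 (cid (pairing_exists dN k)).

Lemma pairing_gen k j x :
  pairing k (coset_gen V j) x = if j == k then average (V k) x else 0.
Proof.
rewrite /pairing (projT2 (cid (pairing_exists dN k))).
by case: eqP.
Qed.

Lemma pairing_actl k g p x : pairing k (lact g p) x = pairing k p (lact g^-1%g x).
Proof. by rewrite lhom_act. Qed.

Lemma pairing_act k g p x : pairing k (lact g p) (lact g x) = pairing k p x.
Proof. by rewrite pairing_actl lactK. Qed.

Lemma pairingPl k x a p q :
  pairing k (a *: p + q) x = a *: pairing k p x + pairing k q x.
Proof. by rewrite linearP. Qed.

Lemma pairing_linearl k x : linear (fun p => pairing k p x).
Proof. by move=> a p q; exact: pairingPl. Qed.

Lemma pairing_linearr k p : linear (pairing k p : N -> N).
Proof.
move: p; apply: (coset_module_ind (S := [set p | linear (pairing k p : N -> N)])).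
  split=> [|a p q /= pl ql b x y] /=; first by move=> a x y; rewrite linear0 scaler0 addr0.
  rewrite !linearP /= !fctE pl ql !scalerDr !scalerA.
  by rewrite addrACA.
move=> j g a x y; rewrite !pairing_actl linearP !pairing_gen.
case: eqP => _; last by rewrite scaler0 addr0.
by rewrite (average_linear (cosubP _) dN).
Qed.

Lemma pairing0l k x : pairing k 0 x = 0.
Proof. by rewrite (linear0 (pairing k)). Qed.

Lemma pairing0r k p : pairing k p 0 = 0.
Proof. exact: (linear0 (linear_map (pairing_linearr k p))). Qed.

Lemma pairing_fixed k p x : fixed_by (V k) (pairing k p x).
Proof.
move: p x; suff h p : [set p | forall x, fixed_by (V k) (pairing k p x)] p by exact: h.
apply: coset_module_ind => [|j g x v Vv].
  split=> [x v _|a q r /= qf rf x]; first by rewrite linear0 linear0.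
  by rewrite linearP; apply: (fixed_by_closed _ _).2.
rewrite pairing_actl pairing_gen; case: eqP => _; last by rewrite linear0.
by rewrite average_fixed //; exact: cosubP.
Qed.

(** Both sides equal the pairing of the two averages: against a fixed vector, the
    pairing does not see a translation of the other variable. *)
Lemma pairing_average (U : set G) k p x : compact_open_subgroup U ->
  pairing k (average U p) x = pairing k p (average U x).
Proof.
move=> coU; have dL := @coset_module_ldiscrete _ _ V; have sU : subgroup U by case: coU.
transitivity (pairing k (average U p) (average U x)).
  apply/esym/(average_invariant coU dN); first exact: pairing_linearr.
  move=> v m Uv; rewrite -[in LHS](average_fixed coU dL p Uv).
  exact: pairing_act.
apply: (average_invariant coU dL (f := fun p => pairing k p (average U x))).
  exact: pairing_linearl.
move=> v m Uv; rewrite -[in LHS](average_fixed coU dN x Uv).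
exact: pairing_act.
Qed.

End Pairing.

Lemma pairing_lhom (G : topologicalGroupType) n (V : 'I_n -> cosubgroup G)
    (M N : lmodQG G) (dM : ldiscrete M) (dN : ldiscrete N) (f : lhom M N) k p x :
  f (pairing V dM k p x) = pairing V dN k p (f x).
Proof.
move: p x; suff h p : [set p | forall x,
    f (pairing V dM k p x) = pairing V dN k p (f x)] p by exact: h.
apply: coset_module_ind => [|j g x].
  split=> [x|a q r /= qf rf x].
    by rewrite !(linear0 (pairing V _ k)); exact: linear0.
  by rewrite !pairingPl linearP /= qf rf.
rewrite !pairing_actl !pairing_gen -lhom_act; case: eqP => _.
  by rewrite (average_lhom _ _ (cosubP _)).
exact: linear0.
Qed.

(** * Tensor products *)

Section TensorTheory.
Variable G : groupType.
Implicit Types (A B C : rmodQG G) (M N : lmodQG G).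

Lemma tens_linearr A M (a : A) : linear (tens a : M -> tensor A M).
Proof. by have [_ + _] := tens_balanced A M; exact. Qed.

Lemma tens_linearl A M (m : M) : linear (fun a : A => tens a m).
Proof. by have [+ _ _] := tens_balanced A M; exact. Qed.

HB.instance Definition _ A M (a : A) :=
  GRing.isLinear.Build rat M (tensor A M) *:%R (tens a) (tens_linearr a).

(** The first variable is put last so that linearity in it can be inferred. *)
Definition tens_left A M (m : M) (a : A) : tensor A M := tens a m.
HB.instance Definition _ A M (m : M) :=
  GRing.isLinear.Build rat A (tensor A M) *:%R (tens_left m) (tens_linearl m).

Lemma tens0l A M (m : M) : tens (0 : A) m = 0.
Proof. exact: (linear0 (tens_left m)). Qed.

Lemma tensZl A M (q : rat) (a : A) (m : M) : tens (q *: a) m = q *: tens a m.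
Proof. exact: (linearZ_LR (tens_left m)). Qed.

Lemma tens_suml A M (I : Type) (r : seq I) (F : I -> A) (m : M) :
  tens (\sum_(i <- r) F i) m = \sum_(i <- r) tens (F i) m.
Proof. exact: (linear_sum (tens_left m)). Qed.

Lemma tens0r A M (a : A) : tens a (0 : M) = 0.
Proof. exact: (linear0 (tens a : {linear M -> tensor A M})). Qed.

Lemma tens_act A M (a : A) g (m : M) : tens (ract a g) m = tens a (lact g m).
Proof. by have [_ _ +] := tens_balanced A M; exact. Qed.

Lemma tensor_ind A M (S : set (tensor A M)) : subspace_closed S ->
  (forall a m, S (tens a m)) -> forall t, S t.
Proof.
move=> sS St t; rewrite -(qclass_repr t).
move: (repr _) => x.
apply: (malg_ind (S := [set x | S (qclass _ x)])) => [|[a m]]; last exact: St.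
split=> [|q y z /= Sy Sz]; first by rewrite /= linear0; exact: sS.1.
by rewrite /= linearP; exact: sS.2.
Qed.

Lemma tensor_ext A M (W : lmodType rat) (f h : {linear tensor A M -> W}) :
  (forall a m, f (tens a m) = h (tens a m)) -> f =1 h.
Proof.
move=> fh t; apply: (tensor_ind (S := [set t | f t = h t])) => //.
by split=> /= [|q x y fx fy]; rewrite ?linear0 // !linearP fx fy.
Qed.

Section RightMap.
Variables (A : rmodQG G) (M N : lmodQG G) (f : lhom M N).
Lemma tensor_mapr_balanced : balanced (fun (a : A) m => tens a (f m)).
Proof.
split=> [m|a q x y|a g m]; first exact: tens_linearl.
  by rewrite !linearP.
by rewrite tens_act lhom_act.
Qed.
Definition tensor_mapr : tensor A M -> tensor A N :=
  tensor_lift (fun a m => tens a (f m)).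
Lemma tensor_mapr_linear : linear tensor_mapr.
Proof. exact/tensor_lift_linear/tensor_mapr_balanced. Qed.
HB.instance Definition _ := GRing.isLinear.Build rat (tensor A M) (tensor A N)
  *:%R tensor_mapr tensor_mapr_linear.
Lemma tensor_maprE a m : tensor_mapr (tens a m) = tens a (f m).
Proof. exact/tensor_liftE/tensor_mapr_balanced. Qed.
End RightMap.
Arguments tensor_mapr A {M N} f _.

Lemma tensor_map_mapr A B (i : rhom A B) M N (f : lhom M N) t :
  tensor_map i N (tensor_mapr A f t) = tensor_mapr B f (tensor_map i M t).
Proof.
apply: (tensor_ext (f := tensor_map i N \o tensor_mapr A f)
  (h := tensor_mapr B f \o tensor_map i M)) => a m /=.
by rewrite tensor_maprE !tensor_mapE tensor_maprE.
Qed.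

Lemma tensor_mapr_comp A M N P (h : lhom N P) (f : lhom M N) (k : lhom M P) t :
  (forall x, h (f x) = k x) -> tensor_mapr A h (tensor_mapr A f t) = tensor_mapr A k t.
Proof.
move=> hfk; apply: (tensor_ext (f := tensor_mapr A h \o tensor_mapr A f)) => a m /=.
by rewrite !tensor_maprE hfk.
Qed.

Lemma tensor_mapr_id A M (f : lhom M M) t : f =1 id -> tensor_mapr A f t = t.
Proof.
move=> fid; apply: (tensor_ext (h := idfun)) => a m /=.
by rewrite tensor_maprE fid.
Qed.

(** Modulo the image of [i], the tensor of a lift of [c] with [m] depends only on
    [c] and [m]; this gives a map on the tensor product with [C] that recovers the
    class of a tensor from its image. *)
Lemma tensor_right_exact A B C (i : rhom A B) (p : rhom B C) M :
  short_exact i p ->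
  range (tensor_map i M) = [set y | tensor_map p M y = 0] /\
  range (tensor_map p M) = setT.
Proof.
move=> [_ ip pS].
have surj c : exists b, p b = c.
  by have : range p c by [rewrite pS]; move=> [b _ <-]; exists b.
pose X := range (tensor_map i M).
have sX : subspace_closed X.
  split=> [|a _ _ [x _ <-] [y _ <-]]; first by exists 0; rewrite ?linear0.
  by exists (a *: x + y); rewrite ?linearP.
have cls b b' m : p b = p b' -> qclass X (tens b m) = qclass X (tens b' m).
  move=> pb; apply/qclass_eq; rewrite span_id //.
  have : range i (b - b') by rewrite ip /= linearB /= pb subrr.
  move=> [a _ iab]; exists (tens a m) => //; rewrite tensor_mapE iab.
  exact: (linearB (tens_left m)).
pose sec c := projT1 (cid (surj c)).
have secK c : p (sec c) = c by exact: projT2 (cid (surj c)).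
pose beta (c : C) (m : M) := qclass X (tens (sec c) m).
have bb : balanced beta.
  split=> [m q c c'|c q m m'|c g m]; rewrite /beta; last 2 first.
  - by rewrite !linearP.
  - by rewrite -tens_act; apply: cls; rewrite rhom_act !secK.
  have -> : q *: qclass X (tens (sec c) m) + qclass X (tens (sec c') m) =
      qclass X (tens (q *: sec c + sec c') m).
    by rewrite -linearP (tens_linearl m).
  by apply: cls; rewrite linearP !secK.
split; last first.
  apply/seteqP; split=> // t _; apply: tensor_ind => [|c m].
    split=> [|a _ _ [x _ <-] [y _ <-]]; first by exists 0; rewrite ?linear0.
    by exists (a *: x + y); rewrite ?linearP.
  by exists (tens (sec c) m) => //; rewrite tensor_mapE secK.
apply/seteqP; split=> [_ [t _ <-] /=|t /= pt].
  apply: (tensor_ext (f := tensor_map p M \o tensor_map i M) (h := \0)) => a m /=.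
  rewrite !tensor_mapE (_ : p (i a) = 0); first exact: (linear0 (tens_left m)).
  by have : range i (i a) by [exists a]; rewrite ip.
have lift_p : tensor_lift beta (tensor_map p M t) = qclass X t.
  have [F FE] : exists F : {linear tensor C M -> quot_span X}, F =1 tensor_lift beta.
    by exists (linear_map (tensor_lift_linear bb)).
  rewrite -FE.
  apply: (tensor_ext (f := F \o tensor_map p M) (h := qclass X)) => b m /=.
  by rewrite tensor_mapE FE tensor_liftE //; apply: cls; rewrite secK.
suff : span X t by rewrite span_id.
apply/qclass_eq0; rewrite -lift_p pt.
exact: (linear0 (linear_map (tensor_lift_linear bb))).
Qed.

End TensorTheory.
Arguments tensor_mapr {G} A {M N} f _.
Global Opaque tensor tensor_lift tensor_map tensor_mapr tens.

(** * Flatness *)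

Section FlatCriterion.
Variable G : topologicalGroupType.

Definition preserves_injections (M : lmodQG G) :=
  forall (A B : rmodQG G) (i : rhom A B), rdiscrete A -> rdiscrete B ->
    injective i -> injective (tensor_map i M).

Lemma preserves_injections_flat (M : lmodQG G) : preserves_injections M -> flat M.
Proof.
move=> Mi A B C i p dA dB dC ip; have [iI _ _] := ip.
have [ei ep] := tensor_right_exact M ip.
by apply: And3 ei ep; exact: Mi dA dB iI.
Qed.

Lemma retract_preserves_injections (P L : lmodQG G) (p : lhom L P) (s : lhom P L) :
  cancel s p -> preserves_injections L -> preserves_injections P.
Proof.
move=> sK Li A B i dA dB iI t u tu.
have sI (t' : tensor A P) : tensor_mapr A p (tensor_mapr A s t') = t'.
  have -> := @tensor_mapr_comp _ A _ _ _ p s (lhom_id P) t' sK.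
  by apply: tensor_mapr_id => x.
apply: (can_inj sI); apply: (Li _ _ _ dA dB iI).
apply: etrans (tensor_map_mapr i s t) _.
exact: etrans (congr1 (tensor_mapr B s) tu) (esym (tensor_map_mapr i s u)).
Qed.

Section Standard.
Variables (n : nat) (V : 'I_n -> cosubgroup G).

(** A tensor with a generator of stabiliser V_k is unchanged when its coefficient is
    averaged over V_k. *)
Lemma tensor_coset_normal (A : rmodQG G) (dA : rdiscrete A) (t : tensor A (coset_module V)) :
  exists a : 'I_n -> left_of_right A, (forall k, fixed_by (V k) (a k)) /\
    t = \sum_k tens (a k : A) (coset_gen V k).
Proof.
have dA' := left_of_right_discrete dA.
pose S : set (tensor A (coset_module V)) := [set t | exists a : 'I_n -> left_of_right A,
  (forall k, fixed_by (V k) (a k)) /\ t = \sum_k tens (a k : A) (coset_gen V k)].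
have sS : subspace_closed S.
  split=> [|q _ _ [a [af ->]] [b [bf ->]]].
    exists (fun=> 0); split=> [k v _|]; first exact: linear0.
    by rewrite big1 => [|k _]; [|exact: tens0l].
  exists (fun k => q *: a k + b k); split=> [k|].
    by apply: (fixed_by_closed _ _).2.
  rewrite scaler_sumr -big_split; apply: eq_bigr => k _ /=.
  exact: esym (tens_linearl (coset_gen V k) q (a k : A) (b k : A)).
apply: (tensor_ind (S := S)) => // a m.
apply: (coset_module_ind (S := [set m | S (tens a m)])) => [|k g] /=.
  split=> [|q x y xS yS]; first by rewrite /= tens0r; exact: sS.1.
  by rewrite /= (tens_linearr a q x y); exact: sS.2 q _ _ xS yS.
rewrite -tens_act; set b : left_of_right A := ract a g.
have <- : tens (average (V k) b : A) (coset_gen V k) = tens (b : A) (coset_gen V k).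
  apply: (average_invariant (cosubP _) dA' (f := fun b : left_of_right A =>
    tens (b : A) (coset_gen V k))).
    exact: (tens_linearl (coset_gen V k)).
  move=> v c Vv; rewrite tens_act coset_module_gen_fixed //.
  exact: (subgroupV (cosub_subgroup _) Vv).
exists (fun j => if j == k then average (V k) b else 0); split=> [j|].
  case: eqP => [->|_] v Vv; last exact: linear0.
  by apply: average_fixed => //; exact: cosubP.
rewrite (bigD1 k (isT : true)) eqxx /= big1 => [|j /negPf ->]; last exact: tens0l.
by rewrite addr0.
Qed.

Lemma coordinate_balanced (A : rmodQG G) (dA : ldiscrete (left_of_right A)) k :
  balanced (fun (a : A) (p : coset_module V) => pairing V dA k p (a : left_of_right A) : A).
Proof.
split=> [p|a q x y|a g p].
- by move=> q x y; exact: (pairing_linearr dA k p q x y).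
- by rewrite pairingPl.
have -> : (ract a g : left_of_right A) = lact g^-1%g (a : left_of_right A).
  by rewrite /= /op_lact invgK.
by rewrite -pairing_actl.
Qed.

(** The pairing recovers the fixed coefficients of a tensor in normal form,
    so an injection of coefficients cannot kill it. *)
Lemma coset_module_preserves_injections : preserves_injections (coset_module V).
Proof.
move=> A B i dA dB iI; apply: linear_injective => t it0.
have [a [af ta]] := tensor_coset_normal dA t.
have dB' := left_of_right_discrete dB.
suff a0 k : a k = 0.
  rewrite ta big1 => [|k _]; first by [].
  by rewrite a0; exact: tens0l.
apply: iI; rewrite (linear0 i).
have bB := coordinate_balanced dB' k.
have [F FE] : exists F : {linear tensor B (coset_module V) -> B}, F =1
    tensor_lift (fun (b : B) (p : coset_module V) =>
      pairing V dB' k p (b : left_of_right B) : B).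
  by exists (linear_map (tensor_lift_linear bB)).
have : F (tensor_map i (coset_module V) t) = 0 by rewrite it0 linear0.
rewrite ta (linear_sum (tensor_map i (coset_module V))) (linear_sum F).
rewrite (bigD1 k (isT : true)) /= big1 => [|j /negPf jk]; last first.
  by rewrite tensor_mapE FE tensor_liftE // pairing_gen jk.
rewrite addr0 tensor_mapE FE tensor_liftE // pairing_gen eqxx.
rewrite average_id //; first exact: cosubP.
move=> v Vv; have := af k v Vv; rewrite /= /op_lact -rhom_act => <-.
by rewrite -[in RHS](af k v Vv).
Qed.

End Standard.

Lemma fg_proper_preserves_injections (P : lmodQG G) :
  fg_proper_permutation P -> preserves_injections P.
Proof.
move=> /fg_proper_retract[n [V [p [s sK]]]].
exact: (retract_preserves_injections sK (@coset_module_preserves_injections _ V)).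
Qed.

End FlatCriterion.

(** * Quotients and kernels *)

Section Quotient.
Variables (G : groupType) (M : lmodQG G) (X : set M).
Hypothesis X_act : forall g x, X x -> X (lact g x).

Lemma quot_span_ind (P : quot_span X -> Prop) :
  (forall x, P (qclass X x)) -> forall q, P q.
Proof. by move=> Px q; rewrite -(qclass_repr q). Qed.

Section Lift.
Variables (W : lmodType rat) (f : {linear M -> W}).
Hypothesis fX : forall x, X x -> f x = 0.

Definition quot_lift (q : quot_span X) : W :=
  f (repr (q : Quotient.quot (spanb X))).

Lemma quot_liftE x : quot_lift (qclass X x) = f x.
Proof.
apply/eqP; rewrite -subr_eq0 -linearB; apply/eqP.
have /qclass_eq h := qclass_repr (qclass X x).
apply: (h [set y | f y = 0]) => //; exact/ker_closed/linearP.
Qed.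

Lemma quot_lift_linear : linear quot_lift.
Proof.
move=> a x y; elim/quot_span_ind: x => x; elim/quot_span_ind: y => y.
by rewrite -linearP !quot_liftE linearP.
Qed.
End Lift.

Definition quot_act g : quot_span X -> quot_span X :=
  quot_lift (qclass X \o lact g).

Lemma quot_actE g x : quot_act g (qclass X x) = qclass X (lact g x).
Proof.
rewrite /quot_act quot_liftE // => y Xy; apply/qclass_eq0; apply: sub_span; exact: X_act.
Qed.

Lemma quot_act_linear g : linear (quot_act g).
Proof.
apply: quot_lift_linear => y Xy; apply/qclass_eq0; apply: sub_span; exact: X_act.
Qed.

Lemma quot_act1 q : quot_act 1%g q = q.
Proof. by elim/quot_span_ind: q => x; rewrite quot_actE lact1. Qed.

Lemma quot_actM g h q : quot_act (g * h)%g q = quot_act g (quot_act h q).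
Proof. by elim/quot_span_ind: q => x; rewrite !quot_actE lactM. Qed.

Definition quot_module : lmodQG G := LmodQG quot_act_linear quot_act1 quot_actM.

Definition quot_proj : lhom M quot_module :=
  @make_lhom _ M quot_module _ (@linearP _ _ _ _ (qclass X))
    (fun g x => esym (quot_actE g x)).

Lemma quot_proj_surj (q : quot_module) : exists x, quot_proj x = q.
Proof. by elim/quot_span_ind: q => x; exists x. Qed.

Lemma quot_proj_eq0 x : quot_proj x = 0 <-> span X x.
Proof. exact: qclass_eq0. Qed.

Lemma quot_lhom_exists (N : lmodQG G) (f : lhom M N) :
  (forall x, X x -> f x = 0) ->
  exists h : lhom quot_module N, forall x, h (quot_proj x) = f x.
Proof.
move=> fX.
have fa g (q : quot_module) : quot_lift f (lact g q) = lact g (quot_lift f q).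
  elim/quot_span_ind: q => x; rewrite [lact g _]quot_actE.
  by rewrite !(quot_liftE fX) lhom_act.
exists (@make_lhom _ quot_module N _ (quot_lift_linear fX) fa) => x.
exact: quot_liftE.
Qed.

End Quotient.

Lemma quot_module_discrete (G : topologicalGroupType) (M : lmodQG G) (X : set M)
    (X_act : forall g x, X x -> X (lact g x)) :
  ldiscrete M -> ldiscrete (quot_module X_act).
Proof.
move=> dM q; have [x <-] := quot_proj_surj q.
have sS := stab_subgroup (quot_proj X_act x).
apply: (subgroup_open_sub sS (dM x)) => [|g gx]; first exact: lact1.
by rewrite /stab /= -[LHS](lhom_act (quot_proj X_act)) gx.
Qed.

Section Kernel.
Variables (G : groupType) (M N : lmodQG G) (f : lhom M N).

Definition kernel_pred : {pred M} := fun x => f x == 0.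

Lemma kernel_submod_closed : submod_closed kernel_pred.
Proof.
split=> [|a x y]; rewrite !unfold_in; first by rewrite linear0.
by move=> /eqP fx /eqP fy; rewrite linearP fx fy scaler0 addr0.
Qed.

HB.instance Definition _ := GRing.isSubmodClosed.Build rat M kernel_pred
  kernel_submod_closed.

Definition kernel_type := {x : M | kernel_pred x}.
HB.instance Definition _ := SubChoice.on kernel_type.
HB.instance Definition _ := [SubChoice_isSubLmodule of kernel_type by <:].

Lemma kernel_act_subproof g (x : kernel_type) : kernel_pred (lact g (val x)).
Proof.
rewrite /kernel_pred lhom_act; have /eqP -> : kernel_pred (val x) := valP x.
by rewrite linear0.
Qed.

Definition kernel_act g (x : kernel_type) : kernel_type :=
  Sub (lact g (val x)) (kernel_act_subproof g x).

Lemma kernel_act_linear g : linear (kernel_act g).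
Proof. by move=> a x y; apply: val_inj; rewrite /= linearP. Qed.

Lemma kernel_act1 x : kernel_act 1%g x = x.
Proof. by apply: val_inj; rewrite /= lact1. Qed.

Lemma kernel_actM g h x : kernel_act (g * h)%g x = kernel_act g (kernel_act h x).
Proof. by apply: val_inj; rewrite /= lactM. Qed.

Definition kernel_module : lmodQG G :=
  LmodQG kernel_act_linear kernel_act1 kernel_actM.

Definition kernel_incl : lhom kernel_module M :=
  @make_lhom _ kernel_module M val (@linearP _ _ _ _ _) (fun _ _ => erefl).

Lemma kernel_incl_inj : injective kernel_incl.
Proof. exact: val_inj. Qed.

Lemma kernel_inclE : range kernel_incl = [set x | f x = 0].
Proof.
apply/seteqP; split=> [_ [x _ <-] /=|x /eqP fx]; first exact/eqP/(valP x).
by exists (Sub x fx : kernel_type).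
Qed.

End Kernel.

Lemma kernel_module_discrete (G : topologicalGroupType) (M N : lmodQG G)
    (f : lhom M N) : ldiscrete M -> ldiscrete (kernel_module f).
Proof.
move=> dM x; have -> : [set g | lact g x = x] = [set g | lact g (val x) = val x].
  apply/seteqP; split=> g /= gx; first by rewrite -[in RHS]gx.
  exact: val_inj.
exact: dM.
Qed.

(** * From flatness to factoring relations *)

Section FlatExact.
Variables (G : topologicalGroupType) (M : lmodQG G).
Hypothesis M_flat : flat M.

Lemma flat_preserves_injections (L N : lmodQG G) (f : lhom L N) :
  ldiscrete L -> ldiscrete N -> injective f ->
  injective (tensor_map (rhom_of_lhom f) M).
Proof.
move=> dL dN fI; have [sR aR] := range_closed f.
have dQ := quot_module_discrete (X_act := aR) dN.
pose i := rhom_of_lhom f; pose p := rhom_of_lhom (quot_proj aR).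
have ip : short_exact i p.
  split=> //; apply/seteqP; split=> [_ [x _ <-]|x] //=.
  - by apply: (quot_proj_eq0 aR _).2; apply: sub_span; exists x.
  - by move/(quot_proj_eq0 aR _).1 => h; exact: h sR (fun _ => id).
  - by move=> _; have [y <-] := quot_proj_surj x; exists y.
have [] // := M_flat (right_of_left_discrete dL) (right_of_left_discrete dN)
  (right_of_left_discrete dQ) ip.
Qed.

(** Factor [f] through the quotient by its kernel: flatness makes both the
    injection and the short exact sequence of the kernel survive tensoring. *)
Lemma flat_kernel (L N : lmodQG G) (f : lhom L N)
    (t : tensor (right_of_left L) M) :
  ldiscrete L -> ldiscrete N -> tensor_map (rhom_of_lhom f) M t = 0 ->
  exists s : seq (L * M), (forall x, x \in s -> f x.1 = 0) /\
    t = \sum_(x <- s) tens (x.1 : right_of_left L) x.2.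
Proof.
move=> dL dN ft0; pose X := [set x : L | f x = 0].
have sX : subspace_closed X by apply: ker_closed; exact: linearP.
have aX g x : X x -> X (lact g x) by rewrite /X /= lhom_act => ->; rewrite linear0.
have dQ := quot_module_discrete (X_act := aX) dL.
pose p := quot_proj aX; pose i := kernel_incl f.
have ip : short_exact (rhom_of_lhom i) (rhom_of_lhom p).
  split; first exact: kernel_incl_inj.
    rewrite [LHS](kernel_inclE f); apply/seteqP; split=> x /=.
      by move=> fx; apply: (quot_proj_eq0 aX _).2; exact: sub_span.
    by move/(quot_proj_eq0 aX _).1 => h; exact: h sX (fun _ => id).
  apply/seteqP; split=> // x _; have [y <-] := quot_proj_surj x.
  by exists y.
have [j jE] := @quot_lhom_exists _ _ _ aX _ f (fun _ => id).
have jI : injective j.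
  apply: linear_injective => q; have [x <-] := quot_proj_surj q.
  by rewrite jE => fx; apply: (quot_proj_eq0 aX _).2; exact: sub_span.
have pt0 : tensor_map (rhom_of_lhom p) M t = 0.
  apply: (flat_preserves_injections dQ dN jI); rewrite linear0 -ft0.
  apply: (tensor_ext (f := tensor_map (rhom_of_lhom j) M \o
    tensor_map (rhom_of_lhom p) M)) => a m /=.
  by rewrite !tensor_mapE /= jE.
have [_ ex _] := M_flat (right_of_left_discrete (kernel_module_discrete (f := f) dL))
  (right_of_left_discrete dL) (right_of_left_discrete dQ) ip.
have [u _ <-] : range (tensor_map (rhom_of_lhom i) M) t by rewrite ex.
pose S := [set u | exists s : seq (L * M), (forall x, x \in s -> f x.1 = 0) /\
  tensor_map (rhom_of_lhom i) M u =
    \sum_(x <- s) tens (x.1 : right_of_left L) x.2].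
suff : S u by [].
apply: tensor_ind => [|a m]; last first.
  exists [:: (i a, m)]; rewrite big_seq1 tensor_mapE; split=> // x.
  rewrite inE => /eqP -> /=; have : range i (i a) by exists a.
  by rewrite kernel_inclE.
split=> [|q x y [s [sf xs]] [r [rf yr]]].
  by exists [::]; rewrite big_nil linear0.
exists ([seq (q *: z.1, z.2) | z <- s] ++ r); split=> [z|].
  rewrite mem_cat => /orP[/mapP[w /sf fw ->]|/rf //] /=.
  by rewrite linearZ /= fw scaler0.
rewrite linearP /= xs yr big_cat big_map scaler_sumr; congr (_ + _).
apply: eq_bigr => z _; exact/esym/tensZl.
Qed.

End FlatExact.

Section Adjunction.
Variables (G : topologicalGroupType) (n : nat) (V : 'I_n -> cosubgroup G).

Lemma tens_average (M N : lmodQG G) (dN : ldiscrete N) (U : set G) (c : N) (m : M) :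
  compact_open_subgroup U -> fixed_by U m ->
  tens (average U c : right_of_left N) m = tens (c : right_of_left N) m.
Proof.
move=> coU mU; have sU : subgroup U by case: coU.
apply: (average_invariant coU dN (f := fun c : N => tens (c : right_of_left N) m)).
  exact: (@tens_linearl _ (right_of_left N) M m).
move=> v x Uv; have -> : lact v x = ract (x : right_of_left N) v^-1%g.
  by rewrite /= /op_ract invgK.
by rewrite tens_act mU //; exact: subgroupV.
Qed.

(** The map [f] is encoded by the tensor [\sum_k w_k (x) f w_k]. Transposing a vector
    [y] turns this tensor into [c (x) f y], which vanishes when [y] is a
    relation. *)
Lemma sum_tens_pairing (M N : lmodQG G) (dN : ldiscrete N) (f : lhom (coset_module V) M)
    (y : coset_module V) (c : N) :
  \sum_k tens (pairing V dN k y c : right_of_left N) (f (coset_gen V k)) =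
  tens (c : right_of_left N) (f y).
Proof.
move: y; apply: (@coset_module_ind _ _ _ [set y |
  \sum_k tens (pairing V dN k y c : right_of_left N) (f (coset_gen V k)) =
  tens (c : right_of_left N) (f y)]) => [|j g] /=.
  split=> /= [|a x y /= xS yS].
    rewrite (linear0 f) tens0r big1 => [|k _]; first by [].
    by rewrite pairing0l tens0l.
  rewrite linearP /= (@tens_linearr _ (right_of_left N) M c a (f x) (f y)) -xS -yS.
  rewrite scaler_sumr -big_split; apply: eq_bigr => k _ /=.
  by rewrite pairingPl (@tens_linearl _ (right_of_left N) M).
rewrite (bigD1 j (isT : true)) /= big1 => [|k /negPf kj]; last first.
  by rewrite pairing_actl pairing_gen eq_sym kj; exact: tens0l.
rewrite addr0 pairing_actl pairing_gen eqxx tens_average //.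
- have -> : lact g^-1%g c = ract (c : right_of_left N) g by [].
  by rewrite tens_act lhom_act.
- exact: cosubP.
- by move=> v Vv; rewrite -lhom_act coset_module_gen_fixed.
Qed.

Section Hom.
Variables (N : lmodQG G) (dN : ldiscrete N).

Definition pairing_hom (p : coset_module V) (x : N) : lhom (coset_module V) N :=
  coset_module_lift (fun k => @pairing_fixed _ _ V N dN k p x).

Lemma pairing_hom_gen p x k : pairing_hom p x (coset_gen V k) = pairing V dN k p x.
Proof. exact: coset_module_liftE. Qed.

Lemma pairing_homPl a p q x y :
  pairing_hom (a *: p + q) x y = a *: pairing_hom p x y + pairing_hom q x y.
Proof.
move: y; apply: (@coset_module_ind _ _ _ [set y | pairing_hom (a *: p + q) x y =
  a *: pairing_hom p x y + pairing_hom q x y]) => [|k g] /=.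
  split=> /= [|b y z /= yS zS]; first by rewrite !linear0 ?scaler0 addr0.
  rewrite !linearP /= yS zS !scalerDr !scalerA (mulrC b) addrACA.
  by [].
by rewrite !lhom_act !pairing_hom_gen pairingPl linearP.
Qed.

Lemma pairing_hom0l x y : pairing_hom 0 x y = 0.
Proof.
by have := pairing_homPl 1 0 0 x y; rewrite scaler0 addr0 scale1r -[LHS]addr0 => /addrI.
Qed.

Lemma pairing_hom_act g p x y :
  pairing_hom (lact g p) x y = pairing_hom p (lact g^-1%g x) y.
Proof.
move: y; apply: (lhom_ext (@coset_module_generated _ _ V)) => _ [k _ <-].
by rewrite !pairing_hom_gen pairing_actl.
Qed.

Lemma pairing_hom_basis_gen j g k x :
  pairing_hom (coset_gen V j) x (lact g (coset_gen V k)) =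
  if j == k then lact g (average (V k) x) else 0.
Proof.
by rewrite lhom_act pairing_hom_gen pairing_gen; case: eqP => // _; rewrite linear0.
Qed.

End Hom.
End Adjunction.

Section Relations.
Variables (G : topologicalGroupType) (n r : nat) (V : 'I_n -> cosubgroup G).
Variables (U : cosubgroup G) (y : 'I_r -> coset_module V).
Hypothesis yU : forall l, fixed_by U (y l).

Notation free_rel := (coset_module (fun _ : 'I_r => U)).
Notation rel_gen := (coset_gen (fun _ : 'I_r => U)).
Let dR : ldiscrete free_rel := @coset_module_ldiscrete _ _ _.

Lemma dual_map_fixed k :
  fixed_by (V k) (\sum_l pairing V dR k (y l) (rel_gen l)).
Proof.
apply: (subspace_sum (fixed_by_closed _ _)) => l _; exact: pairing_fixed.
Qed.

(** The transpose of the map that sends the generators of the source to the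
    relations [y], both modules being identified with their duals. *)
Definition dual_map : lhom (coset_module V) free_rel := coset_module_lift dual_map_fixed.

Variables (N : lmodQG G) (dN : ldiscrete N).

(** The pairing after the transpose of [p] is the pairing after evaluation at [p],
    because averaging is self-adjoint. *)
Lemma pairing_pairing l j p c x :
  pairing (fun _ : 'I_r => U) dN l (pairing V dR j p c) x =
  pairing (fun _ : 'I_r => U) dN l c (pairing_hom dN (coset_gen V j) x p).
Proof.
move: p; apply: (@coset_module_ind _ _ _ [set p |
  pairing (fun _ : 'I_r => U) dN l (pairing V dR j p c) x =
  pairing (fun _ : 'I_r => U) dN l c (pairing_hom dN (coset_gen V j) x p)])
  => [|k g] /=.
  split=> /= [|a p q /= pS qS].
    by rewrite !pairing0l linear0 pairing0r.
  by rewrite !pairingPl linearP /= pairing_linearr pS qS.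
rewrite pairing_hom_basis_gen pairing_actl pairing_gen eq_sym; case: eqP => [->|_].
  by rewrite pairing_average ?pairing_actl ?invgK //; exact: cosubP.
by rewrite pairing0l pairing0r.
Qed.

(** In particular the homomorphism attached to [p] kills every relation as soon
    as the transpose kills [p]. Here the [U]-invariance of the relations is
    what removes the last average. *)
Lemma pairing_hom_rel l p x :
  pairing_hom dN p x (y l) = pairing (fun _ : 'I_r => U) dN l (dual_map p) x.
Proof.
move: p x; suff h p : [set p | forall x, pairing_hom dN p x (y l) =
  pairing (fun _ : 'I_r => U) dN l (dual_map p) x] p by exact: h.
apply: coset_module_ind => [|j g x].
  split=> /= [x|a q q' qS qS' x].
    by rewrite pairing_hom0l linear0 pairing0l.
  by rewrite pairing_homPl linearP /= pairingPl qS qS'.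
rewrite pairing_hom_act lhom_act pairing_actl; move: (lact _ x) => {}x.
rewrite /dual_map coset_module_liftE (linear_sum (pairing (fun _ : 'I_r => U) dN l)) fct_sumE.
under eq_bigr do rewrite pairing_pairing pairing_gen.
rewrite -big_mkcond big_pred1_eq average_id //; first exact: cosubP.
by move=> v Uv; rewrite -lhom_act yU.
Qed.

End Relations.

Section FlatFactor.
Variable G : topologicalGroupType.
Hypotheses (lcG : locally_compact [set: G]) (tdG : totally_disconnected [set: G]).
Implicit Types M N P : lmodQG G.

Lemma cosubgroup_fixing M (dM : ldiscrete M) (s : seq M) :
  exists U : cosubgroup G, forall x, x \in s -> fixed_by U x.
Proof.
have so : open [set g : G | forall x, x \in s -> lact g x = x].
  by apply: stab_seq_open => x _; exact: dM.
have [|U coU US] := van_dantzig lcG tdG so; first by move=> x _; exact: lact1.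
by exists (CoSubgroup coU) => x xs v /US; exact.
Qed.

Variables (M : lmodQG G) (dM : ldiscrete M).

Lemma op_pairing_balanced n (V : 'I_n -> cosubgroup G) k :
  balanced (fun (p : right_of_left (coset_module V)) (m : M) => pairing V dM k p m).
Proof.
split=> [m a p q|p|p g m].
- exact: pairingPl.
- exact: pairing_linearr.
- by rewrite /= /op_ract pairing_actl invgK.
Qed.

(** The tensor [tau] that encodes [f] is killed by the transpose of the relations, so
    by flatness it is a sum of tensors [kap_i (x) m_i] with [kap_i] in the kernel of
    the transpose. Pairing with the [kap_i] gives a map to the coset module on
    generators lying over the [m_i]; it kills the relations, and it lifts [f] because
    pairing [tau] itself gives back [f]. *)
Lemma flat_kills_relations n (V : 'I_n -> cosubgroup G) (f : lhom (coset_module V) M)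
    (ys : seq (coset_module V)) :
  flat M -> (forall y, y \in ys -> f y = 0) ->
  exists m (W : 'I_m -> cosubgroup G) (f' : lhom (coset_module V) (coset_module W))
    (f3 : lhom (coset_module W) M),
    (forall y, y \in ys -> f' y = 0) /\ (forall x, f x = f3 (f' x)).
Proof.
move=> flM fys; have dV := @coset_module_ldiscrete _ _ V.
have [U Uys] := cosubgroup_fixing dV ys.
pose y (l : 'I_(size ys)) := tnth (in_tuple ys) l.
have yU l : fixed_by U (y l) by apply: Uys; exact: mem_tnth.
pose F := dual_map U y.
have dR : ldiscrete (coset_module (fun _ : 'I_(size ys) => U)).
  exact: coset_module_ldiscrete.
pose tau : tensor (right_of_left (coset_module V)) M :=
  \sum_k tens (coset_gen V k : right_of_left (coset_module V)) (f (coset_gen V k)).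
have Ftau : tensor_map (rhom_of_lhom F) M tau = 0.
  rewrite /tau (linear_sum (tensor_map (rhom_of_lhom F) M)).
  rewrite (eq_bigr (fun k => \sum_l tens (pairing V (@coset_module_ldiscrete _ _ _) k (y l)
    (coset_gen (fun _ : 'I_(size ys) => U) l) : right_of_left _) (f (coset_gen V k)))).
    rewrite exchange_big big1 /= => [|l _]; first by [].
    by rewrite sum_tens_pairing fys ?tens0r //; exact: mem_tnth.
  move=> k _; rewrite /= tensor_mapE.
  have -> : rhom_of_lhom F (coset_gen V k : right_of_left (coset_module V)) =
    \sum_l pairing V (@coset_module_ldiscrete _ _ _) k (y l)
      (coset_gen (fun _ : 'I_(size ys) => U) l) by exact: coset_module_liftE.
  exact: (@tens_suml _ (right_of_left _) M).
have [s [sF tauE]] := flat_kernel flM dV dR Ftau.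
pose kap (i : 'I_(size s)) := (tnth (in_tuple s) i).1.
pose m (i : 'I_(size s)) := (tnth (in_tuple s) i).2.
have kapF i : F (kap i) = 0 by apply: sF; exact: mem_tnth.
have {}tauE : tau = \sum_i tens (kap i : right_of_left (coset_module V)) (m i).
  by rewrite tauE (big_tnth _ _ s).
have Wex i : exists W : cosubgroup G, fixed_by W (m i).
  have [W Wm] := cosubgroup_fixing dM [:: m i].
  by exists W; apply: Wm; rewrite inE.
pose W i := projT1 (cid (Wex i)).
have Wm i : fixed_by (W i) (m i) by exact: (projT2 (cid (Wex i))).
have dW := @coset_module_ldiscrete _ _ W.
pose f3 := coset_module_lift Wm.
have ff k : fixed_by (V k) (\sum_i pairing V dW k (kap i) (coset_gen W i)).
  apply: (subspace_sum (fixed_by_closed _ _)) => i _; exact: pairing_fixed.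
pose f' := coset_module_lift ff.
have f'E x : f' x = \sum_i pairing_hom dW (kap i) (coset_gen W i) x.
  move: x; apply: (@coset_module_ind _ _ _ [set x | f' x =
    \sum_i pairing_hom dW (kap i) (coset_gen W i) x]) => [|k g] /=.
    split=> /= [|a x z /= xS zS].
      by rewrite linear0 big1 // => i _; exact: linear0.
    rewrite linearP /= xS zS scaler_sumr -big_split; apply: eq_bigr => i _.
    by rewrite linearP.
  rewrite lhom_act coset_module_liftE linear_sum; apply: eq_bigr => i _.
  by rewrite lhom_act pairing_hom_gen.
exists (size s), W, f', f3; split=> [z|].
  move=> /(tnthP (in_tuple ys))[l ->]; rewrite f'E big1 // => i _.
  rewrite (pairing_hom_rel yU) kapF.
  exact: pairing0l.
apply: (lhom_ext (h := lhom_comp f3 f') (@coset_module_generated _ _ V)) => _ [k _ <-].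
rewrite lhom_compE coset_module_liftE linear_sum.
have bk := op_pairing_balanced V k.
have [B BE] : exists B : {linear tensor (right_of_left (coset_module V)) M -> M}, B =1
    tensor_lift (fun (p : right_of_left (coset_module V)) (m : M) => pairing V dM k p m).
  by exists (linear_map (tensor_lift_linear bk)).
have <- : B tau = f (coset_gen V k).
  rewrite /tau (linear_sum B) (bigD1 k (isT : true)) /= big1 => [|j /negPf jk].
    rewrite addr0 BE tensor_liftE // pairing_gen eqxx average_id //.
      exact: cosubP.
    by move=> v Vv; rewrite -lhom_act coset_module_gen_fixed.
  by rewrite BE tensor_liftE // pairing_gen jk.
rewrite tauE (linear_sum B); apply: eq_bigr => i _.
by rewrite BE tensor_liftE // (pairing_lhom dW dM) coset_module_liftE.
Qed.

Definition factors_relations M :=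
  forall (P1 P2 : lmodQG G) (f : lhom P1 P2) (phi2 : lhom P2 M),
    fg_proper_permutation P1 -> fg_proper_permutation P2 ->
    (forall x, phi2 (f x) = 0) ->
    exists (P3 : lmodQG G) (f' : lhom P2 P3) (phi3 : lhom P3 M),
      [/\ fg_proper_permutation P3, (forall x, f' (f x) = 0)
        & (forall y, phi2 y = phi3 (f' y))].

Lemma flat_factors_relations : flat M -> factors_relations M.
Proof.
move=> flM P1 P2 f phi [_ [xs gxs]] /fg_proper_retract[n [V [p [s sK]]]] phif.
have [|m [W [f' [f3 [f'0 f3E]]]]] := flat_kills_relations
  (f := lhom_comp phi p) (ys := [seq s (f x) | x <- xs]) flM.
  by move=> _ /mapP[x _ ->]; rewrite lhom_compE sK.
exists (coset_module W), (lhom_comp f' s), f3; split=> [|x|y].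
- exact: coset_module_fg_proper.
- suff : [set x | f' (s (f x)) = 0] x by [].
  rewrite (gxs [set x | f' (s (f x)) = 0]) // => [|z zs] /=; last first.
    by apply: f'0; exact: (map_f (fun x => s (f x))).
  split=> /= [|g z /= fz]; last by rewrite !lhom_act fz linear0.
  by split=> /= [|a z w /= fz fw]; rewrite ?linear0 // !linearP /= fz fw scaler0 addr0.
- by rewrite lhom_compE -f3E lhom_compE sK.
Qed.

End FlatFactor.

Local Arguments lact : simpl never.

(** * Direct limits *)

Section DirectedSystem.
Variables (G : groupType) (D : directed_system G).

Section Concrete.
Variables (M : lmodQG G) (c : forall i, lhom (dsys_obj D i) M).
Hypothesis c_cocone : cocone c.

Definition jointly_surjective := forall m, exists i x, c i x = m.

Definition kernels_vanish := forall i x, c i x = 0 ->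
  exists j (ij : dsys_le i j), dsys_map ij x = 0.

Hypotheses (c_surj : jointly_surjective) (c_ker : kernels_vanish).

Lemma equal_at_later_stage i j x y : c i x = c j y ->
  exists k (ik : dsys_le i k) (jk : dsys_le j k), dsys_map ik x = dsys_map jk y.
Proof.
move=> cxy; have [k [ik jk]] := dsys_directed i j.
have : c k (dsys_map ik x - dsys_map jk y) = 0.
  by rewrite linearB /= !c_cocone cxy subrr.
move=> /c_ker[l [kl kl0]].
have il := dsys_trans ik kl; have jl := dsys_trans jk kl.
exists l, il, jl; rewrite (dsys_comp ik kl) (dsys_comp jk kl).
by apply/eqP; rewrite -subr_eq0 -linearB kl0.
Qed.

Lemma descends (Z : Type) (b : forall i, dsys_obj D i -> Z) :
  (forall i j (ij : dsys_le i j) x, b j (dsys_map ij x) = b i x) ->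
  exists h : M -> Z, forall i x, h (c i x) = b i x.
Proof.
move=> bD.
have pre m : exists u : {i & dsys_obj D i}, c (projT1 u) (projT2 u) = m.
  by have [i [x <-]] := c_surj m; exists (existT _ i x).
exists (fun m => b _ (projT2 (projT1 (cid (pre m))))) => i x.
case: (cid _) => -[j y] /= /equal_at_later_stage[k [jk [ik e]]].
by rewrite -(bD _ _ jk) e bD.
Qed.

Lemma common_stage m m' : exists i x x', c i x = m /\ c i x' = m'.
Proof.
have [i [x <-]] := c_surj m; have [j [y <-]] := c_surj m'.
have [k [ik jk]] := dsys_directed i j.
by exists k, (dsys_map ik x), (dsys_map jk y); rewrite !c_cocone.
Qed.

Lemma descends_linear (N : lmodType rat) (b : forall i, {linear dsys_obj D i -> N})
    (h : M -> N) : (forall i x, h (c i x) = b i x) -> linear h.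
Proof.
move=> hb a m m'; have [i [x [x' [<- <-]]]] := common_stage m m'.
by rewrite -linearP !hb linearP.
Qed.

Lemma descends_lhom (N : lmodQG G) (d : forall i, lhom (dsys_obj D i) N) :
  cocone d -> exists h : lhom M N, forall i x, h (c i x) = d i x.
Proof.
move=> dD; have [h hd] := descends dD.
have ha g m : h (lact g m) = lact g (h m).
  by have [i [x <-]] := c_surj m; rewrite -lhom_act !hd lhom_act.
exists (make_lhom (descends_linear (b := fun i => lhom_fun (d i)) hd) ha) => i x.
exact: hd.
Qed.

End Concrete.

Notation obj := (dsys_obj D).
Notation germ := {i & obj i}.

(** The index type carries no choice structure, so germs borrow the classical one. *)
Definition germ_act (g : G) (u : {classic germ}) : {classic germ} :=
  existT _ (projT1 u) (lact g (projT2 u)).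

Lemma germ_act1 u : germ_act 1%g u = u.
Proof. by case: u => i x; rewrite /germ_act /= lact1. Qed.

Lemma germ_actM g h u : germ_act (g * h)%g u = germ_act g (germ_act h u).
Proof. by case: u => i x; rewrite /germ_act /= lactM. Qed.

Definition germ_gSet : gSet G := GSet germ_act1 germ_actM.

Notation free_germs := (permutation_module germ_gSet).
Definition germ_elt i (x : obj i) : free_germs :=
  basis_elt (existT _ i x : germ_gSet).

Lemma germ_elt_act g i (x : obj i) : lact g (germ_elt x) = germ_elt (lact g x).
Proof. by rewrite /germ_elt -basis_elt_act. Qed.

Definition germ_relations : set free_germs :=
  [set z | (exists i q x y,
              z = germ_elt (q *: x + y : obj i) - (q *: germ_elt x + germ_elt y))
        \/ (exists i j (ij : dsys_le i j) x, z = germ_elt (dsys_map ij x) - germ_elt x)].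

Lemma germ_relations_act g z : germ_relations z -> germ_relations (lact g z).
Proof.
move=> [[i [q [x [y ->]]]]|[i [j [ij [x ->]]]]].
  left; exists i, q, (lact g x), (lact g y).
  by rewrite linearB linearP /= !germ_elt_act linearP.
by right; exists i, j, ij, (lact g x); rewrite linearB /= !germ_elt_act lhom_act.
Qed.

Definition colimit : lmodQG G := quot_module germ_relations_act.

Definition to_colimit_fun i (x : obj i) : colimit :=
  quot_proj germ_relations_act (germ_elt x).

Lemma to_colimit_linear i : linear (@to_colimit_fun i).
Proof.
move=> q x y; apply/eqP; rewrite -subr_eq0 /to_colimit_fun -linearP -linearB.
by apply/eqP; apply: (quot_proj_eq0 _ _).2; apply: sub_span; left; exists i, q, x, y.
Qed.

Lemma to_colimit_act i g (x : obj i) :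
  to_colimit_fun (lact g x) = lact g (to_colimit_fun x).
Proof. by rewrite /to_colimit_fun -germ_elt_act lhom_act. Qed.

Definition to_colimit i : lhom (obj i) colimit :=
  make_lhom (@to_colimit_linear i) (@to_colimit_act i).

Lemma to_colimitE i (x : obj i) :
  to_colimit i x = quot_proj germ_relations_act (germ_elt x).
Proof. by []. Qed.

Lemma to_colimit_cocone : cocone to_colimit.
Proof.
move=> i j ij x; apply/eqP; rewrite -subr_eq0 !to_colimitE -linearB.
by apply/eqP; apply: (quot_proj_eq0 _ _).2; apply: sub_span; right; exists i, j, ij, x.
Qed.

Lemma to_colimit_surj : jointly_surjective to_colimit.
Proof.
move=> q; have [z <-] := quot_proj_surj q.
apply: (@malg_ind _ [set z : free_germs | exists i x,
  to_colimit i x = quot_proj germ_relations_act z]) => [|[i x]]; last by exists i, x.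
split=> [|a y y' [i [u iu]] [j [v jv]]].
  by have [i] := dsys_inhabited D; exists i, 0; rewrite !linear0.
have [k [ik jk]] := dsys_directed i j.
exists k, (a *: dsys_map ik u + dsys_map jk v).
rewrite linearP !to_colimit_cocone iu jv; exact/esym/linearP.
Qed.

(** Germs that do not map to stage [k] are sent to zero, which is harmless because only
    late stages matter. *)
Definition push k (u : {classic germ}) : obj k :=
  if @idP (dsys_le (projT1 u) k) is ReflectT h then dsys_map h (projT2 u) else 0.

Lemma pushE k i (ik : dsys_le i k) (x : obj i) :
  push k (existT _ i x) = dsys_map ik x.
Proof.
rewrite /push; case: {-}_ / idP => [h|/(_ ik) []] /=.
by rewrite (bool_irrelevance h ik).
Qed.

(** Pushing germs to all late stages kills every relation, hence every element
    of their span. *)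
Lemma to_colimit_ker : kernels_vanish to_colimit.
Proof.
move=> i x /quot_proj_eq0 x0.
pose S := [set z : free_germs | exists k, forall j, dsys_le k j ->
  free_lift (push j) z = 0].
have [||k kS] := x0 S.
- split=> [|a y z [k yk] [l zl]].
    by have [k] := dsys_inhabited D; exists k => j _; rewrite linear0.
  have [m [km lm]] := dsys_directed k l; exists m => j mj.
  rewrite free_lift_is_linear yk ?zl ?scaler0 ?addr0 //.
    exact: dsys_trans lm mj.
  exact: dsys_trans km mj.
- move=> _ [[k [q [y [z ->]]]]|[k [l [kl [y ->]]]]].
    exists k => j kj; rewrite linearB linearP /= !free_liftU.
    by rewrite !(pushE kj) linearP subrr.
  exists l => j lj; rewrite linearB /= !free_liftU (pushE lj).
  by rewrite (pushE (dsys_trans kl lj)) -(dsys_comp kl lj (dsys_trans kl lj)) subrr.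
have [j [ij kj]] := dsys_directed i k; exists j, ij.
by have := kS j kj; rewrite free_liftU (pushE ij).
Qed.

End DirectedSystem.

Section DirectLimit.
Variables (G : topologicalGroupType) (D : directed_system G).

Lemma colimit_discrete :
  (forall i, ldiscrete (dsys_obj D i)) -> ldiscrete (colimit D).
Proof.
move=> dD q; have [i [x <-]] := to_colimit_surj q.
have sS := stab_subgroup (to_colimit i x).
apply: (subgroup_open_sub sS (dD i x)) => [|g gx]; first exact: lact1.
exact: etrans (esym (lhom_act (to_colimit i) g x)) (congr1 (to_colimit i) gx).
Qed.

Variables (M : lmodQG G) (c : forall i, lhom (dsys_obj D i) M).

(** The concrete colimit is discrete, so the universal property makes [M] isomorphic
    to it. *)
Lemma direct_limit_concrete : (forall i, ldiscrete (dsys_obj D i)) ->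
  is_direct_limit c -> ldiscrete M ->
  jointly_surjective c /\ kernels_vanish c.
Proof.
move=> dD [cD cU] dM.
have [h [hc _]] := cU _ _ (colimit_discrete dD) (@to_colimit_cocone _ D).
have [k kc] := descends_lhom (@to_colimit_cocone _ D) (@to_colimit_surj _ D)
  (@to_colimit_ker _ D) cD.
have [u [_ uU]] := cU _ _ dM cD.
have kh m : k (h m) = m.
  have -> : k (h m) = u m by apply: (uU (lhom_comp k h)) => i x; rewrite lhom_compE hc kc.
  by rewrite -(uU (lhom_id M)).
split=> [m|i x cx].
  have [i [x ix]] := to_colimit_surj (h m).
  by exists i, x; rewrite -kc ix kh.
by apply: to_colimit_ker; rewrite -hc cx linear0.
Qed.

Lemma concrete_direct_limit : cocone c ->
  jointly_surjective c -> kernels_vanish c -> is_direct_limit c.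
Proof.
move=> cD cS cK; split=> // N d _ dD; have [h hd] := descends_lhom cD cS cK dD.
exists h; split=> // h' h'd m; have [i [x <-]] := cS m.
by rewrite h'd hd.
Qed.

End DirectLimit.

(** * Tensor products of direct limits *)

Section TensorSystem.
Variable G : groupType.

(** With the trivial action, systems of vector spaces become systems of modules, so that
    the colimit built above applies to tensor products. *)
Definition trivial_module (U : lmodType rat) : lmodQG G :=
  @LmodQG G U (fun _ x => x) (fun _ _ _ _ => erefl) (fun _ => erefl)
    (fun _ _ _ => erefl).

Definition trivial_lhom (U W : lmodType rat) (f : {linear U -> W}) :
  lhom (trivial_module U) (trivial_module W) :=
  @LHom G (trivial_module U) (trivial_module W) f (fun _ _ => erefl).

Variables (A : rmodQG G) (D : directed_system G).

Lemma tensor_system_id i (ii : @dsys_le _ D i i) x :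
  trivial_lhom (tensor_mapr A (dsys_map ii)) x = x.
Proof. apply: tensor_mapr_id; exact: dsys_id. Qed.

Lemma tensor_system_comp i j k (ij : @dsys_le _ D i j) (jk : dsys_le j k)
    (ik : dsys_le i k) x :
  trivial_lhom (tensor_mapr A (dsys_map ik)) x =
  trivial_lhom (tensor_mapr A (dsys_map jk)) (trivial_lhom (tensor_mapr A (dsys_map ij)) x).
Proof.
apply/esym/tensor_mapr_comp => y; exact/esym/dsys_comp.
Qed.

Definition tensor_system : directed_system G :=
  @DirectedSystem G _ _ (@dsys_refl _ D) (@dsys_trans _ D) (dsys_inhabited D)
    (@dsys_directed _ D) (fun i => trivial_module (tensor A (dsys_obj D i)))
    (fun i j ij => trivial_lhom (tensor_mapr A (dsys_map ij)))
    tensor_system_id tensor_system_comp.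

Variables (M : lmodQG G) (c : forall i, lhom (dsys_obj D i) M).
Hypotheses (cD : cocone c) (cS : jointly_surjective c) (cK : kernels_vanish c).

Lemma tensor_surj (t : tensor A M) : exists i u, t = tensor_mapr A (c i) u.
Proof.
pose S := [set t | exists i u, t = tensor_mapr A (c i) u].
suff : S t by [].
apply: tensor_ind => [|a m]; last first.
  by have [i [x <-]] := cS m; exists i, (tens a x); rewrite tensor_maprE.
split=> [|q _ _ [i [u ->]] [j [v ->]]].
  by have [i] := dsys_inhabited D; exists i, 0; rewrite linear0.
have [k [ik jk]] := dsys_directed i j.
exists k, (q *: tensor_mapr A (dsys_map ik) u + tensor_mapr A (dsys_map jk) v).
have <- := tensor_mapr_comp (k := c i) u (cD ik).
have <- := tensor_mapr_comp (k := c j) v (cD jk).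
apply: esym; exact: (@tensor_mapr_linear _ A _ _ (c k) q).
Qed.

Notation toT := (@to_colimit _ tensor_system).

(** The tensor product with the limit maps to the colimit of the tensor products,
    and there a vanishing class vanishes at some stage. *)
Lemma tensor_ker i (u : tensor A (dsys_obj D i)) : tensor_mapr A (c i) u = 0 ->
  exists j (ij : dsys_le i j), tensor_mapr A (dsys_map ij) u = 0.
Proof.
move=> u0.
have bex a : exists b : M -> colimit tensor_system,
    forall i x, b (c i x) = toT i (tens a x).
  apply: (descends cD cS cK) => k l kl x.
  rewrite -(@to_colimit_cocone _ tensor_system k l kl) /=.
  by rewrite tensor_maprE.
pose b a := projT1 (cid (bex a)).
have bE a j x : b a (c j x) = toT j (tens a x) by exact: (projT2 (cid (bex a))).
have bb : balanced b.
  split=> [m q a a'|a q m m'|a g m].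
  - have [j [x <-]] := cS m.
    by rewrite !bE (tens_linearl x q a a') linearP.
  - have [j [x [x' [<- <-]]]] := common_stage cD cS m m'.
    by rewrite -linearP !bE (tens_linearr a q x x') linearP.
  - by have [j [x <-]] := cS m; rewrite -lhom_act !bE tens_act.
have [F FE] : exists F : {linear tensor A M -> colimit tensor_system},
    F =1 tensor_lift b by exists (linear_map (tensor_lift_linear bb)).
have Fc v : F (tensor_mapr A (c i) v) = toT i v.
  apply: (tensor_ext (f := F \o tensor_mapr A (c i)) (h := lhom_fun (toT i))) => a x /=.
  by rewrite tensor_maprE FE tensor_liftE // bE.
have /to_colimit_ker[j [ij iju]] : toT i u = 0 by rewrite -Fc u0 linear0.
by exists j, ij.
Qed.

End TensorSystem.

Lemma limit_preserves_injections (G : topologicalGroupType) (D : directed_system G)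
    (M : lmodQG G) (c : forall i, lhom (dsys_obj D i) M) :
  cocone c -> jointly_surjective c -> kernels_vanish c ->
  (forall i, preserves_injections (dsys_obj D i)) -> preserves_injections M.
Proof.
move=> cD cS cK Di A B f dA dB fI; apply: linear_injective => t.
have [i [u ->]] := tensor_surj cD cS t.
move=> fu; have : tensor_mapr B (c i) (tensor_map f _ u) = 0.
  exact: etrans (esym (tensor_map_mapr f (c i) u)) fu.
move=> /(tensor_ker cD cS cK)[j [ij iju]].
have fiju : tensor_map f _ (tensor_mapr A (dsys_map ij) u) = 0.
  exact: etrans (tensor_map_mapr f (dsys_map ij) u) iju.
have u0 : tensor_mapr A (dsys_map ij) u = 0.
  apply: (Di j A B f dA dB fI); rewrite fiju; exact/esym/linear0.
have <- := tensor_mapr_comp (k := c i) u (cD i j ij).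
by rewrite u0 linear0.
Qed.

(** * Building a directed system *)

Section Lazard.
Variable G : topologicalGroupType.
Hypotheses (lcG : locally_compact [set: G]) (tdG : totally_disconnected [set: G]).
Variables (M : lmodQG G) (dM : ldiscrete M).
Hypothesis M_factors : factors_relations M.

(** Labels make the system a preorder: a map respecting labelled generators is
    unique. The second component of a label is the vector of [M] below the labelled
    element; the first leaves room for arbitrarily many elements over the same
    vector. *)
Record stage := Stage {
  stage_size : nat;
  stage_subgroups : 'I_stage_size -> cosubgroup G;
  stage_map : lhom (coset_module stage_subgroups) M;
  stage_labels : seq (nat * M);
  stage_elt : nat * M -> coset_module stage_subgroups;
  stage_eltP : forall t, t \in stage_labels -> stage_map (stage_elt t) = t.2;
  stage_gen : generates [set x | exists2 t, t \in stage_labels & x = stage_elt t]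
}.

Notation obj i := (coset_module (@stage_subgroups i)).

Definition transition (i j : stage) (tau : lhom (obj i) (obj j)) :=
  {subset stage_labels i <= stage_labels j} /\
  forall t, t \in stage_labels i -> tau (stage_elt i t) = stage_elt j t.

Definition stage_le : rel stage := fun i j => `[< exists tau, @transition i j tau >].

Definition stage_transition (i j : stage) (ij : stage_le i j) : lhom (obj i) (obj j) :=
  projT1 (cid (asboolW ij)).

Lemma stage_transitionP i j (ij : stage_le i j) : transition (stage_transition ij).
Proof. exact: (projT2 (cid (asboolW ij))). Qed.

Lemma transition_unique i j (s tau : lhom (obj i) (obj j)) :
  transition s -> transition tau -> s =1 tau.
Proof.
move=> [_ sE] [_ tE]; apply: (lhom_ext (@stage_gen i)) => _ [t ti ->].
by rewrite sE // tE.
Qed.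

Lemma transition_id i : transition (lhom_id (obj i)).
Proof. by split. Qed.

Lemma transition_comp i j k (s : lhom (obj i) (obj j)) (tau : lhom (obj j) (obj k)) :
  transition s -> transition tau -> transition (lhom_comp tau s).
Proof.
move=> [ij sE] [jk tE]; split=> [t /ij/jk //|t ti].
by rewrite lhom_compE sE // tE //; exact: ij.
Qed.

Lemma stage_refl : reflexive stage_le.
Proof. by move=> i; apply/asboolP; exists (lhom_id (obj i)); exact: transition_id. Qed.

Lemma stage_trans : transitive stage_le.
Proof.
move=> j i k /asboolP[s sP] /asboolP[tau tP]; apply/asboolP.
by exists (lhom_comp tau s); exact: transition_comp.
Qed.

Lemma stage_transition_id i (ii : stage_le i i) x : stage_transition ii x = x.
Proof. exact: (transition_unique (stage_transitionP ii) (transition_id i)). Qed.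

Lemma stage_transition_comp i j k (ij : stage_le i j) (jk : stage_le j k)
    (ik : stage_le i k) x :
  stage_transition ik x = stage_transition jk (stage_transition ij x).
Proof.
apply: (transition_unique (stage_transitionP ik)
  (transition_comp (stage_transitionP ij) (stage_transitionP jk))).
Qed.

Lemma stage_map_transition i j (tau : lhom (obj i) (obj j)) x :
  transition tau -> stage_map j (tau x) = stage_map i x.
Proof.
move=> [ij tE].
apply: (lhom_ext (f := lhom_comp (stage_map j) tau) (@stage_gen i)) => _ [t ti ->].
by rewrite lhom_compE tE // !stage_eltP //; exact: ij.
Qed.

(** Factor the relations [ys] through a coset module over [M], and give fresh labels to
    its generators so that the labelled elements generate it. *)
Lemma stage_extension n (V : 'I_n -> cosubgroup G) (f : lhom (coset_module V) M)
    (J : seq (nat * M)) (p : nat * M -> coset_module V) (ys : seq (coset_module V)) :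
  (forall t, t \in J -> f (p t) = t.2) -> (forall y, y \in ys -> f y = 0) ->
  exists (j : stage) (a : lhom (coset_module V) (obj j)),
    [/\ {subset J <= stage_labels j}, forall t, t \in J -> a (p t) = stage_elt j t,
        forall y, y \in ys -> a y = 0 & forall x, f x = stage_map j (a x)].
Proof.
move=> fp fys; have dV := @coset_module_ldiscrete _ _ V.
have [U Uys] := cosubgroup_fixing lcG tdG dV ys.
pose y (l : 'I_(size ys)) := tnth (in_tuple ys) l.
have yU l : fixed_by U (y l) by apply: Uys; exact: mem_tnth.
pose r := @coset_module_lift _ _ (fun _ : 'I_(size ys) => U) _ y yU.
have fr x : f (r x) = 0.
  apply: (@coset_module_ind _ _ _ [set x | f (r x) = 0]) => [|l g].
    by split=> [|b z w /= z0 w0]; rewrite /= ?linear0 // !linearP /= z0 w0 scaler0 addr0.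
  by rewrite /= !lhom_act coset_module_liftE fys ?linear0 //; exact: mem_tnth.
have [P3 [f' [f3 [fgP3 f'r f3E]]]] :=
  M_factors (@coset_module_fg_proper _ _ _) (@coset_module_fg_proper _ _ V) fr.
have [m [W [q [s sK]]]] := fg_proper_retract fgP3.
pose g := lhom_comp f3 q; pose a := lhom_comp s f'.
have ga x : g (a x) = f x by rewrite /g /a !lhom_compE sK -f3E.
have [N JN] : exists N, forall t, t \in J -> (t.1 < N)%N.
  by exists (\max_(t <- J) t.1).+1 => t tJ; rewrite ltnS; exact: leq_bigmax_seq.
pose new (i : 'I_m) : nat * M := ((N + i)%N, g (coset_gen W i)).
pose elt (t : nat * M) : coset_module W :=
  if t \in J then a (p t) else oapp (coset_gen W) 0 (insub (t.1 - N)%N).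
have newJ i : new i \in J = false.
  by apply/negP => /JN; rewrite /new /= ltnNge leq_addr.
have elt_new i : elt (new i) = coset_gen W i.
  have iN : ((new i).1 - N)%N = i by exact: addKn.
  by rewrite /elt newJ iN valK.
pose labels := J ++ [seq new i | i <- enum 'I_m].
have eltP t : t \in labels -> g (elt t) = t.2.
  rewrite mem_cat => /orP[tJ|/mapP[i _ ->]]; last by rewrite elt_new.
  by rewrite /elt tJ ga fp.
have elt_gen : generates [set x | exists2 t, t \in labels & x = elt t].
  move=> S sS XS; apply: coset_module_generated => // _ [i _ <-]; apply: XS.
  exists (new i); last by rewrite elt_new.
  by rewrite mem_cat map_f ?orbT // mem_enum.
exists (Stage eltP elt_gen), a; split=> /= [t tJ|t tJ|z|x].
- by rewrite mem_cat tJ.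
- by rewrite /elt tJ.
- move=> /(tnthP (in_tuple ys))[l ->]; rewrite /a lhom_compE.
  have -> : tnth (in_tuple ys) l = r (coset_gen _ l) by exact/esym/coset_module_liftE.
  by rewrite f'r linear0.
- by rewrite ga.
Qed.

Definition empty_family (i : 'I_0) : cosubgroup G :=
  match notF (ltn_ord i) with end.

Lemma stage_inhabited : inhabited stage.
Proof.
have fx k : fixed_by (empty_family k) (0 : M) by case: k.
by have [||j _] := @stage_extension 0 empty_family (coset_module_lift fx)
  [::] (fun=> 0) [::].
Qed.

(** Take the sum of the two stages and kill the differences between elements that
    carry the same label. *)
Lemma stage_directed i j : exists k, stage_le i k /\ stage_le j k.
Proof.
case: i => n1 V1 f1 J1 p1 p1P gen1; case: j => n2 V2 f2 J2 p2 p2P gen2.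
pose V (k : 'I_(n1 + n2)) := match fintype.split k with inl u => V1 u | inr u => V2 u end.
have V_l u : V (lshift n2 u) = V1 u by rewrite /V (unsplitK (inl u)).
have V_r u : V (rshift n1 u) = V2 u by rewrite /V (unsplitK (inr u)).
have fx1 u : fixed_by (V1 u) (coset_gen V (lshift n2 u)).
  by rewrite -V_l => v; exact: coset_module_gen_fixed.
have fx2 u : fixed_by (V2 u) (coset_gen V (rshift n1 u)).
  by rewrite -V_r => v; exact: coset_module_gen_fixed.
pose in1 := coset_module_lift fx1; pose in2 := coset_module_lift fx2.
pose fk (k : 'I_(n1 + n2)) : M :=
  match fintype.split k with inl u => f1 (coset_gen V1 u) | inr u => f2 (coset_gen V2 u) end.
have fkx k : fixed_by (V k) (fk k).
  rewrite /V /fk; case: (fintype.split k) => u v Vv.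
    by rewrite -lhom_act coset_module_gen_fixed.
  by rewrite -lhom_act coset_module_gen_fixed.
pose f := coset_module_lift fkx.
have fin1 x : f (in1 x) = f1 x.
  apply: (lhom_ext (f := lhom_comp f in1) (@coset_module_generated _ _ V1)) => _ [u _ <-].
  by rewrite lhom_compE !coset_module_liftE /fk (unsplitK (inl u)).
have fin2 x : f (in2 x) = f2 x.
  apply: (lhom_ext (f := lhom_comp f in2) (@coset_module_generated _ _ V2)) => _ [u _ <-].
  by rewrite lhom_compE !coset_module_liftE /fk (unsplitK (inr u)).
pose p t := if t \in J1 then in1 (p1 t) else in2 (p2 t).
pose ys := [seq in1 (p1 t) - in2 (p2 t) | t <- J1 & t \in J2].
have [||k [a [Jk ak ay fa]]] := @stage_extension _ V f (J1 ++ J2) p ys.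
- move=> t; rewrite mem_cat /p; case: ifP => [t1 _|_ /= t2].
    by rewrite fin1 p1P.
  by rewrite fin2 p2P.
- move=> _ /mapP[t tJ ->]; move: tJ; rewrite mem_filter => /andP[t2 t1].
  by rewrite linearB /= fin1 fin2 p1P // p2P // subrr.
exists k; split; apply/asboolP.
  exists (lhom_comp a in1); split=> /= t t1; first by apply: Jk; rewrite mem_cat t1.
  by rewrite lhom_compE -ak ?mem_cat ?t1 // /p t1.
exists (lhom_comp a in2); split=> /= t t2; first by apply: Jk; rewrite mem_cat t2 orbT.
rewrite lhom_compE -ak ?mem_cat ?t2 ?orbT // /p; case: ifP => // t1.
apply/esym/eqP; rewrite -subr_eq0 -linearB ay //.
by apply/mapP; exists t; rewrite // mem_filter t2.
Qed.

Definition stage_system : directed_system G :=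
  @DirectedSystem G stage stage_le stage_refl stage_trans stage_inhabited
    stage_directed (fun i => obj i) stage_transition
    stage_transition_id stage_transition_comp.

Definition stage_cocone (i : dsys_index stage_system) :
  lhom (dsys_obj stage_system i) M := stage_map i.

(** A vector of [M] occurs at a stage with one generator over it, and an element over zero
    is a relation, hence dies later. *)
Lemma stage_direct_limit : is_direct_limit stage_cocone.
Proof.
apply: concrete_direct_limit => [i j ij x|m|i x x0].
- exact: stage_map_transition (stage_transitionP ij).
- have [U Um] := cosubgroup_fixing lcG tdG dM [:: m].
  have fx (k : 'I_1) : fixed_by U m by apply: Um; rewrite inE.
  have [||j [a [_ _ _ ja]]] // :=
    @stage_extension 1 (fun=> U) (coset_module_lift fx) [::] (fun=> 0) [::].
  exists j, (a (coset_gen _ ord0)); rewrite /stage_cocone -ja.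
  exact: coset_module_liftE.
have [||j [a [Jj aj a0 fa]]] := @stage_extension _ _ (stage_map i)
    (stage_labels i) (stage_elt i) [:: x].
- exact: stage_eltP.
- by move=> z; rewrite inE => /eqP ->.
have ta : transition a by split.
have ij : stage_le i j by apply/asboolP; exists a.
exists j, ij; rewrite /= (transition_unique (stage_transitionP ij) ta).
by apply: a0; rewrite inE.
Qed.

End Lazard.

(** * The equivalence *)

Section DirectLimitFlat.
Variables (G : topologicalGroupType) (M : lmodQG G).

Lemma fg_proper_discrete (P : lmodQG G) : fg_proper_permutation P -> ldiscrete P.
Proof.
move=> /fg_proper_retract[n [V [p [s sK]]]] x.
apply: (subgroup_open_sub (stab_subgroup x) (coset_module_ldiscrete (s x))).
  exact: lact1.
by move=> g gx; apply: (can_inj sK); rewrite lhom_act.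
Qed.

Lemma direct_limit_flat (D : directed_system G)
    (c : forall i, lhom (dsys_obj D i) M) :
  (forall i, fg_proper_permutation (dsys_obj D i)) -> ldiscrete M ->
  is_direct_limit c -> flat M.
Proof.
move=> Dfg dM cL; apply: preserves_injections_flat.
have [cS cK] := direct_limit_concrete (fun i => fg_proper_discrete (Dfg i)) cL dM.
have [cD _] := cL.
apply: (limit_preserves_injections cD cS cK) => i.
exact: fg_proper_preserves_injections.
Qed.

End DirectLimitFlat.

Theorem theorem1p6 (G : topologicalGroupType)
    (G_locally_compact : locally_compact [set: G])
    (G_totally_disconnected : totally_disconnected [set: G])
    (M : lmodQG G) (M_discrete : ldiscrete M) :
  (flat M <->
   (forall (P1 P2 : lmodQG G) (f : lhom P1 P2) (phi2 : lhom P2 M),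
      fg_proper_permutation P1 -> fg_proper_permutation P2 ->
      (forall x, phi2 (f x) = 0%R) ->
      exists (P3 : lmodQG G) (f' : lhom P2 P3) (phi3 : lhom P3 M),
        [/\ fg_proper_permutation P3,
            (forall x, f' (f x) = 0%R)
          & (forall y, phi2 y = phi3 (f' y))])) /\
  (flat M <->
   (exists (D : directed_system G) (c : forall i, lhom (dsys_obj D i) M),
      (forall i, fg_proper_permutation (dsys_obj D i)) /\
      is_direct_limit c)).
Proof.
have factors_limit : factors_relations M ->
    exists (D : directed_system G) (c : forall i, lhom (dsys_obj D i) M),
      (forall i, fg_proper_permutation (dsys_obj D i)) /\ is_direct_limit c.
  move=> Mf; exists (stage_system G_locally_compact G_totally_disconnected Mf).
  exists (@stage_cocone _ G_locally_compact G_totally_disconnected _ Mf).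
  split=> [i|]; first exact: coset_module_fg_proper.
  exact: stage_direct_limit.
have limit_flat : (exists (D : directed_system G)
      (c : forall i, lhom (dsys_obj D i) M),
      (forall i, fg_proper_permutation (dsys_obj D i)) /\ is_direct_limit c) ->
    flat M.
  by move=> [D [c [Dfg cL]]]; exact: direct_limit_flat cL.
have flat_factors : flat M -> factors_relations M.
  exact: flat_factors_relations.
split; split.
- exact: flat_factors.
- by move=> /factors_limit /limit_flat.
- by move=> /flat_factors /factors_limit.
- exact: limit_flat.
Qed.
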